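(* For every fixed constant number of machines $m$, the problem $Qm|rej|C_{\max}$ can be solved in $\widetilde{O}((p_{\max}+w_{\max})^{(m+2)(m+3)}\cdot n)$ time, where $n$ is the number of jobs, $p_{\max}=\max_j p_j$ and $w_{\max}=\max_j w_j$.
   Context: Problem $Qm|rej|C_{\max}$: given $n$ jobs $J=[n]$ with processing requirements $p_j\in\mathbb{N}$ and weights $w_j\in\mathbb{N}$, a rejection budget $W\in\mathbb{N}$, and $m$ machines with positive speeds $q_i$ (processing time of job $j$ on machine $i$ is $p_j/q_i$). One must choose a set $J'\subseteq J$ of accepted jobs with $\sum_{j\in J\setminus J'}w_j\le W$ and an assignment $\sigma:J'\to[m]$; the makespan is $\max_{i\in[m]}\sum_{j\in\sigma^{-1}(i)}p_j/q_i$, and the goal is to minimize it. The number $m$ is a fixed constant. $\widetilde{O}(\cdot)$ suppresses polylogarithmic factors. *)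

(* Defs.v *)
From mathcomp Require Import all_boot all_order all_algebra.

Set Implicit Arguments.
Unset Strict Implicit.
Unset Printing Implicit Defensive.

Import Order.TTheory GRing.Theory Num.Theory.

Local Open Scope nat_scope.

(* An instance of Qm|rej|C_max. Naturals include 0; speeds are rational, so   *)
(* that an instance is a finite object.                                       *)
Record instance (m : nat) := Instance {
  njobs : nat;
  ptime : 'I_njobs -> nat;
  weight : 'I_njobs -> nat;
  budget : nat;
  speed : 'I_m -> rat;
  speed_gt0 : forall i : 'I_m, (0 < speed i)%R
}.

Definition pmax m (I : instance m) : nat := \max_(j < njobs I) ptime j.
Definition wmax m (I : instance m) : nat := \max_(j < njobs I) weight j.

(* The pair (J', sigma : J' -> [m]) as a partial function: [None] means that  *)
(* the job is rejected, i.e. that it is outside J'.                           *)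
Definition schedule m (I : instance m) := {ffun 'I_(njobs I) -> option 'I_m}.

Definition accepted m (I : instance m) (s : schedule I) : {set 'I_(njobs I)} :=
  [set j | s j != None].

Definition feasible m (I : instance m) (s : schedule I) : bool :=
  \sum_(j in ~: accepted s) weight j <= budget I.

(* The base value 0 of the maximum is harmless, as loads are nonnegative.     *)
Definition makespan m (I : instance m) (s : schedule I) : rat :=
  (\big[Num.max/0]_(i < m)
     \sum_(j | s j == Some i) (ptime j)%:R / speed I i)%R.

Definition optimal m (I : instance m) (s : schedule I) : Prop :=
  feasible s /\
  forall s' : schedule I, feasible s' -> (makespan s <= makespan s')%R.

(* A word RAM, as a structured language. The memory consists of banks (arrays *)
(* of words); a bank is named by a literal of the program, so that a program  *)
(* only uses a fixed number of them, while the address inside a bank is       *)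
(* computed. Scalar variables are cells of banks.                             *)

Inductive binop := Add | Sub | Mul | Div | Eq | Lt.

Inductive expr :=
  | Cst of nat
  | Get of nat & expr
  | Op of binop & expr & expr.

Inductive cmd :=
  | Skip
  | Put of nat & expr & expr
  | Seq of cmd & cmd
  | If of expr & cmd & cmd
  | While of expr & cmd.

Definition memory := nat -> nat -> nat.

Definition update (s : memory) (a k v : nat) : memory :=
  fun a' k' => if (a' == a) && (k' == k) then v else s a' k'.

Definition apply_op (o : binop) (x y : nat) : nat :=
  match o with
  | Add => x + y
  | Sub => x - y
  | Mul => x * y
  | Div => x %/ y
  | Eq => x == y
  | Lt => x < y
  end.

(* Every value occurring in a computation, addresses and intermediate results *)
(* included, has to fit in a word, i.e. be at most [B]; otherwise the machine *)
(* is stuck. This is what makes a unit cost per operation meaningful.         *)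
Definition word (B v : nat) : option nat := if v <= B then Some v else None.

Fixpoint eval (B : nat) (s : memory) (e : expr) : option nat :=
  match e with
  | Cst k => word B k
  | Get a e1 => obind (fun k => word B (s a k)) (eval B s e1)
  | Op o e1 e2 =>
      obind (fun x => obind (fun y => word B (apply_op o x y)) (eval B s e2))
            (eval B s e1)
  end.

Fixpoint cost (e : expr) : nat :=
  match e with
  | Cst _ => 1
  | Get _ e1 => (cost e1).+1
  | Op _ e1 e2 => (cost e1 + cost e2).+1
  end.

(* [exec B c s s' t]: with words bounded by [B], the command [c] started in   *)
(* memory [s] halts in memory [s'] after [t] steps.                           *)
Inductive exec (B : nat) : cmd -> memory -> memory -> nat -> Prop :=
  | ExecSkip s : exec B Skip s s 1
  | ExecPut s a e1 e2 k v :
      eval B s e1 = Some k -> eval B s e2 = Some v ->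
      exec B (Put a e1 e2) s (update s a k v) (cost e1 + cost e2).+1
  | ExecSeq c1 c2 s s1 s2 t1 t2 :
      exec B c1 s s1 t1 -> exec B c2 s1 s2 t2 ->
      exec B (Seq c1 c2) s s2 (t1 + t2)
  | ExecIfTrue e c1 c2 s s' v t :
      eval B s e = Some v -> v != 0 -> exec B c1 s s' t ->
      exec B (If e c1 c2) s s' (cost e + t).+1
  | ExecIfFalse e c1 c2 s s' t :
      eval B s e = Some 0 -> exec B c2 s s' t ->
      exec B (If e c1 c2) s s' (cost e + t).+1
  | ExecWhileFalse e c s :
      eval B s e = Some 0 -> exec B (While e c) s s (cost e).+1
  | ExecWhileTrue e c s s1 s2 v t1 t2 :
      eval B s e = Some v -> v != 0 ->
      exec B c s s1 t1 -> exec B (While e c) s1 s2 t2 ->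
      exec B (While e c) s s2 (cost e + t1 + t2).+1.

(* Banks 0 to 4 hold the input; all the other cells are initially 0.          *)
Definition input m (I : instance m) : seq (seq nat) :=
  [:: [:: njobs I; budget I];
      codom (@ptime m I);
      codom (@weight m I);
      codom (fun i : 'I_m => `|numq (speed I i)|%N);
      codom (fun i : 'I_m => `|denq (speed I i)|%N)].

Definition init_memory m (I : instance m) : memory :=
  fun a k => nth 0 (nth [::] (input I) a) k.

(* Words have O(log N) bits, with N the largest number of the input: they     *)
(* range up to a fixed power of N + 2.                                        *)
Definition word_bound (c : nat) m (I : instance m) : nat :=
  (\max_(v <- flatten (input I)) v).+2 ^ c.

(* The schedule is read in bank 5: cell [j] contains 0 if the job [j] is      *)
(* rejected, and i + 1 if it is assigned to the machine [i].                  *)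
Definition output_is m (I : instance m) (s : schedule I) (st : memory) : Prop :=
  forall j : 'I_(njobs I), st 5 j = (if s j is Some i then i.+1 else 0).

(* O~(f) is O(f * log^k f) for some constant k. The program and the constants *)
(* may depend on [m], but not on the instance. The program is correct on all  *)
(* instances; where [f] vanishes, O~(f) does not bound the time (it would     *)
(* exclude any computation at all), but the program still has to halt.        *)
Definition solvable_in_soft_O m (f : instance m -> nat) : Prop :=
  exists (prog : cmd) (c C k : nat), forall I : instance m,
    exists (st : memory) (t : nat) (s : schedule I),
      [/\ exec (word_bound c I) prog (init_memory I) st t,
          output_is s st,
          optimal s &
          0 < f I -> t <= C * (f I * (trunc_log 2 (f I)).+1 ^ k)].

(* Main.v *)
Require Import Defs.
From mathcomp Require Import all_boot all_order all_algebra.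
From mathcomp Require Import zify ring.

Set Implicit Arguments.
Unset Strict Implicit.
Unset Printing Implicit Defensive.

Import Order.TTheory GRing.Theory Num.Theory.

Local Open Scope nat_scope.

(* A greedy reference schedule rejects jobs by increasing ratio w / p as long *)
(* as the budget permits and assigns every other job to the machine on which  *)
(* it would end first. All its loads are within m * V of those of an optimal  *)
(* schedule, where V = max(p_max, w_max). Read the jobs on which the two      *)
(* disagree as edges between the machines (and the rejection bin). Removing   *)
(* greedily an edge that leaves a bin with a surplus keeps all surpluses in a *)
(* box of side O(V), so that many edges contain a balanced subset, by the     *)
(* pigeonhole principle. Undoing a balanced subset changes no load and does   *)
(* not increase the rejected weight, because the reference rejects by ratio.  *)
(* So some optimal schedule differs from the reference in O(V^(m+1)) jobs,    *)
(* and a dynamic program over the jobs only has to track the deviations of    *)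
(* the m + 1 prefix loads in a window of size O(V^(m+2)).                     *)

(** * Balanced sets of edges *)

(** Bin 0 stands for rejection and bin i + 1 for machine i. All bins, bin 0 included, are loaded by
    processing times, and the rejected weight is a separate cost. Multiplying by the product of the
    numerators of the speeds turns the makespan into the integer [span] ([agrees_makespan]).

    Closeness to the reference has two sources. A fractional knapsack exchange shows that no
    feasible schedule rejects more than V units of processing time beyond the reference
    ([greedy_end]), and list scheduling balances the weighted machine loads up to one job
    ([balance_spec]). A feasible schedule whose span is at most that of the reference thus has loads
    within m * V of it ([balanced_close]). [zero_sum_free_card] bounds the sets of disagreements
    without nonempty balanced subset, so [proximity] can exchange such a schedule for one with equal
    loads and few disagreements, whose prefix loads stay near those of the reference ([load_dist]).

    For each vector of deviations, the dynamic program keeps the least rejected weight, infinite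
    above W. Finite states are realised by schedules ([trace_sound]) and every schedule that stays
    near the reference is seen ([best_complete]); [trace_optimal] combines this with proximity. The
    table has n + 1 layers of (2 * M + 1) ^ (m + 1) states, where M is a constant times (V + 1) ^ (m
    + 2). Together with the V ^ 3 + 1 rounds of the greedy rejection this meets the time bound
    without a logarithmic factor ([running_time_le]). All cells stay at most H, a fixed power of the
    largest input number plus 2, and intermediate values at most H ^ 8 ([eval_value]). *)

Section ZeroSum.

Variables (J T : finType) (src dst : J -> T) (p : J -> nat) (K : nat).
Hypothesis p_le : forall j, p j <= K.

Local Open Scope ring_scope.

(** The surplus of [t] when each [j] is an edge from [src j] to [dst j] carrying [p j]. With [ref]
    as source and [s] as target, it is the load under [ref] minus the load under [s], restricted to
    [R]. *)
Definition net (R : {set J}) (t : T) : int :=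
  \sum_(j in R | src j == t) (p j)%:Z - \sum_(j in R | dst j == t) (p j)%:Z.

Lemma net_alt (R : {set J}) t :
  net R t = \sum_(j in R) ((src j == t)%:Z - (dst j == t)%:Z) * (p j)%:Z.
Proof.
rewrite /net !big_mkcondr /= -sumrB; apply: eq_bigr => j _.
by case: eqP; case: eqP; rewrite /=; lia.
Qed.

Lemma sum_net (R : {set J}) : \sum_t net R t = 0.
Proof.
rewrite sumrB -(partition_big src xpredT) //= -(partition_big dst xpredT) //=.
exact: subrr.
Qed.

Lemma net_setD (R R' : {set J}) t :
  R' \subset R -> net (R :\: R') t = net R t - net R' t.
Proof.
move=> sR; rewrite !net_alt (big_setID R' (A := R)) /=.
by rewrite (setIidPr sR) addrC addrK.
Qed.

Definition next (R : {set J}) : {set J} :=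
  if [pick j in R | 0 < net R (src j)] is Some j then R :\ j else R.

Variable E : {set J}.
Hypothesis net_E : forall t, - K%:Z <= net E t.
Hypothesis no_zero_sum :
  forall Z : {set J}, Z \subset E -> Z != set0 -> exists t, net Z t != 0.

(** Removing an edge lowers at most the surplus of its source, which was positive and drops by at
    most K, so the lower bound survives. Such an edge exists: otherwise no surplus is positive, and
    as they sum to 0 they all vanish, against [no_zero_sum]. *)
Lemma next_spec (R : {set J}) :
  R \subset E -> R != set0 -> (forall t, - K%:Z <= net R t) ->
  [/\ next R \subset R, #|R| = #|next R|.+1 & forall t, - K%:Z <= net (next R) t].
Proof.
move=> sR R0 gR; rewrite /next; case: pickP => [j /andP[jR pos]|none].
  split; first exact: subD1set.
    by rewrite (cardsD1 j R) jR.
  move=> t; rewrite net_setD ?sub1set // [net [set j] t]net_alt big_set1.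
  have := gR t; have := p_le j; move: pos; case: (eqVneq (src j) t) => [->|] /=;
    case: eqP => /=; lia.
have [t nt] := no_zero_sum sR R0; exfalso.
have npos t' : net R t' <= 0.
  rewrite leNgt; apply/negP => pos.
  have : \sum_(j in R | src j == t') (p j)%:Z <= 0.
    rewrite big_pred0 // => j; apply/negP => /andP[jR /eqP tj].
    by have := none j; rewrite jR tj pos.
  move=> h; have : 0 <= \sum_(j in R | dst j == t') (p j)%:Z by apply: sumr_ge0.
  by move: pos; rewrite /net; lia.
have := sum_net R; rewrite (bigD1 t) //= => s0.
have : \sum_(i | i != t) net R i <= 0 by apply: sumr_le0.
have := npos t; move: s0 nt; move: (net R t) (\sum_(i | _) _) => x y.
by move=> s0 /eqP; lia.
Qed.

Lemma iter_next k : (k <= #|E|)%N ->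
  [/\ iter k next E \subset E, #|iter k next E| = (#|E| - k)%N &
      forall t, - K%:Z <= net (iter k next E) t].
Proof.
elim: k => [|k IH] kE; first by rewrite subn0.
have [s cd g] := IH (ltnW kE).
have ne : iter k next E != set0 by rewrite -card_gt0 cd subn_gt0.
have [s' cd' g'] := next_spec s ne g.
split=> //; first exact: subset_trans s' s.
by rewrite /=; lia.
Qed.

Lemma iter_next_sub a b : (a <= b <= #|E|)%N -> iter b next E \subset iter a next E.
Proof.
elim: b => [|b IH]; first by rewrite leqn0 => /andP[/eqP-> _].
case/andP; rewrite leq_eqVlt => /predU1P[->//|ab] bE.
apply: subset_trans (IH _); last by rewrite -ltnS ab ltnW.
have [s cd g] := iter_next (ltnW bE).
have ne : iter b next E != set0 by rewrite -card_gt0 cd subn_gt0.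
by have [] := next_spec s ne g.
Qed.

(** Surpluses are at least -K and sum to 0, so after a shift by K they lie between 0 and #|T| * K.
    The #|E| + 1 successive sets have distinct surplus vectors, since two sets with equal vectors
    would differ by a nonempty balanced set. *)
Lemma zero_sum_free_card : (#|E| < (#|T| * K).+1 ^ #|T|)%N.
Proof.
pose f (a : 'I_#|E|.+1) : {ffun T -> 'I_(#|T| * K).+1} :=
  [ffun t => inord (absz (net (iter a next E) t + K%:Z))].
have good (a : 'I_#|E|.+1) t :
    0 <= net (iter a next E) t + K%:Z <= (#|T| * K)%N%:Z.
  have [_ _ g] := iter_next (ltn_ord a : (a <= _)%N).
  apply/andP; split; first by have := g t; lia.
  have := sum_net (iter a next E); rewrite (bigD1 t) //=.
  have : \sum_(i | i != t) - K%:Z <= \sum_(i | i != t) net (iter a next E) i.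
    by apply: ler_sum.
  rewrite sumr_const (eq_card (B := predC1 t)) // cardC1.
  have : (0 < #|T|)%N by apply/card_gt0P; exists t.
  case: #|T| => // q _ /=; rewrite -mulr_natr => h1 h2.
  move: h1 h2; rewrite mulSn mulNr natz -PoszM mulnC.
  by move: (net _ t) (\sum_(i | _) _) (q * K)%N => x y z; lia.
have inj : injective f.
  move=> a b.
  wlog ab : a b / (a <= b)%N.
    by move=> W e; have [l|l] := leqP a b; [exact: W|apply/esym/W => //; exact: ltnW].
  move=> e; apply: val_inj; apply/eqP; rewrite eqn_leq ab /= leqNgt; apply/negP => lab.
  have [sa ca _] := iter_next (ltn_ord a : (a <= _)%N).
  have [sb cb _] := iter_next (ltn_ord b : (b <= _)%N).
  have sab := iter_next_sub (introT andP (conj ab (ltn_ord b : (b <= _)%N))).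
  have [||t /eqP[]] := @no_zero_sum (iter a next E :\: iter b next E).
  - exact: subset_trans (subsetDl _ _) sa.
  - rewrite -card_gt0 cardsD (setIidPr sab) ca cb.
    by have := ltn_ord a; have := ltn_ord b; lia.
  rewrite net_setD //; have /ffunP/(_ t) := e; rewrite !ffunE => /(congr1 (@nat_of_ord _)).
  have := good a t; have := good b t.
  move: (net (iter a _ _) t) (net (iter b _ _) t) => x y gy gx.
  by rewrite !inordK; lia.
have := leq_card f inj.
by rewrite card_ord card_ffun card_ord.
Qed.

End ZeroSum.

(** * Proximity to the reference schedule *)

Section Schedules.

Variables (n m : nat) (p w : nat -> nat).

Definition load (k : nat) (s : nat -> nat) (i : nat) : nat :=
  \sum_(j < k | s j == i) p j.

Definition rejw (k : nat) (s : nat -> nat) : nat := \sum_(j < k | s j == 0) w j.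

Definition differ (s s' : nat -> nat) : {set 'I_n} := [set j : 'I_n | s j != s' j].

Definition on_bins (s : nat -> nat) : Prop := forall j, j < n -> s j <= m.

Lemma eq_load k s s' i : (forall j, j < k -> s j = s' j) -> load k s i = load k s' i.
Proof. by move=> e; apply: eq_bigl => j; rewrite e. Qed.

Lemma eq_rejw k s s' : (forall j, j < k -> s j = s' j) -> rejw k s = rejw k s'.
Proof. by move=> e; apply: eq_bigl => j; rewrite e. Qed.

Lemma loadS k s i : load k.+1 s i = load k s i + (if s k == i then p k else 0).
Proof. by rewrite /load big_mkcond big_ord_recr /= -big_mkcond. Qed.

Lemma rejwS k s : rejw k.+1 s = rejw k s + (if s k == 0 then w k else 0).
Proof. by rewrite /rejw big_mkcond big_ord_recr /= -big_mkcond. Qed.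

Lemma sum_load s : on_bins s -> \sum_(i < m.+1) load n s i = \sum_(j < n) p j.
Proof.
move=> ps; rewrite /load; under eq_bigr do rewrite big_mkcond /=.
rewrite exchange_big; apply: eq_bigr => j _ /=.
have sj : s j < m.+1 by rewrite ltnS ps.
by rewrite -big_mkcond /= (big_pred1 (Ordinal sj)).
Qed.

(* A set of jobs whose return to [ref] changes no load can be returned to     *)
(* [ref] for free, because [ref] rejects by the ratio w / p, threshold a / b. *)
Lemma proximity (a b K : nat) (ref s : nat -> nat) :
  0 < b ->
  (forall j, j < n -> ref j = 0 -> w j * b <= a * p j) ->
  (forall j, j < n -> ref j != 0 -> a * p j <= w j * b) ->
  (forall j, j < n -> p j <= K) -> on_bins ref -> on_bins s ->
  (forall i, i <= m -> load n s i <= load n ref i + K) ->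
  exists s', [/\ on_bins s', forall i, load n s' i = load n s i,
    rejw n s' <= rejw n s & #|differ ref s'| < (m.+1 * K).+1 ^ m.+1].
Proof.
move=> b0 rej acc pK pr.
have [N] := ubnP #|differ ref s|; elim: N s => // N IH s leN ps close.
have [small|big] := ltnP #|differ ref s| ((m.+1 * K).+1 ^ m.+1); first by exists s.
pose P (j : 'I_n) := p j.
pose rf (j : 'I_n) : 'I_m.+1 := inord (ref j).
pose sf (j : 'I_n) : 'I_m.+1 := inord (s j).
have rfE j i : (rf j == i) = (ref j == i :> nat).
  by rewrite -val_eqE /= inordK // ltnS pr.
have sfE j i : (sf j == i) = (s j == i :> nat).
  by rewrite -val_eqE /= inordK // ltnS ps.
have netE (Z : {set 'I_n}) (i : 'I_m.+1) :
    net rf sf P Z i = (((\sum_(j in Z | ref j == i) p j)%N)%:Z -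
                      ((\sum_(j in Z | s j == i) p j)%N)%:Z)%R.
  rewrite /net; congr (_ - _)%R.
    by rewrite -[RHS]natz natr_sum; apply: eq_big => // j; [rewrite rfE|rewrite natz].
  by rewrite -[RHS]natz natr_sum; apply: eq_big => // j; [rewrite sfE|rewrite natz].
case: (boolP [exists Z : {set 'I_n}, [&& Z \subset differ ref s, Z != set0 &
        [forall i : 'I_m.+1, net rf sf P Z i == 0%R]]]); last first.
  move=> none; exfalso; move: big; apply/negP; rewrite -ltnNge.
  have := @zero_sum_free_card _ _ rf sf P K _ (differ ref s).
  rewrite card_ord; apply.
  - by move=> j; apply: pK.
  (* Jobs on which the schedules agree cancel, so the surplus of a bin over the disagreements is the
     difference of its full loads. *)
  - move=> i; rewrite netE; have := close i (ltn_ord i : i <= m).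
    have split s1 (A := differ ref s) : load n s1 i =
        \sum_(j in A | s1 j == i) p j + \sum_(j in ~: A | s1 j == i) p j.
      rewrite /load (bigID (mem A)) /=; congr (_ + _);
        by apply: eq_bigl => j; rewrite ?inE andbC.
    rewrite (split s) (split ref).
    have -> : \sum_(j in ~: differ ref s | s j == i) p j =
              \sum_(j in ~: differ ref s | ref j == i) p j.
      apply: eq_bigl => j; rewrite !inE negbK.
      by case: eqP => //= ->.
    by lia.
  move=> Z sZ Z0; move/existsPn: none => /(_ Z).
  by rewrite sZ Z0 /= => /forallPn[i hi]; exists i.
case/existsP=> Z /and3P[sZ Z0 /forallP net0].
pose inZ x := x \in [seq val j | j <- enum Z].
have inZE (j : 'I_n) : inZ j = (j \in Z).
  by rewrite /inZ mem_map ?mem_enum //; exact: val_inj.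
pose s' x := if inZ x then ref x else s x.
have sumZ (F : nat -> nat) i :
    \sum_(j < n | s' j == i) F j + \sum_(j in Z | s j == i) F j
    = \sum_(j < n | s j == i) F j + \sum_(j in Z | ref j == i) F j.
  rewrite (bigID (mem Z)) /= [in RHS](bigID (mem Z)) /=.
  have -> : \sum_(j < n | (s' j == i) && (j \in Z)) F j =
            \sum_(j in Z | ref j == i) F j.
    by apply: eq_bigl => j; rewrite /s' inZE andbC; case: (j \in Z).
  have -> : \sum_(j < n | (s' j == i) && (j \notin Z)) F j =
            \sum_(j < n | (s j == i) && (j \notin Z)) F j.
    by apply: eq_bigl => j; rewrite /s' inZE; case: (j \in Z); rewrite ?andbF.
  have -> : \sum_(j < n | (s j == i) && (j \in Z)) F j =
            \sum_(j in Z | s j == i) F j.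
    by apply: eq_bigl => j; rewrite andbC.
  by rewrite addnC [X in _ + X = _]addnC addnA.
have eqZ i : i <= m -> \sum_(j in Z | ref j == i) p j = \sum_(j in Z | s j == i) p j.
  move=> im; have im' : i < m.+1 by [].
  have := net0 (Ordinal im'); rewrite netE /= subr_eq0 => /eqP[].
  by [].
have ps' : on_bins s'.
  by move=> j jn; rewrite /s'; case: ifP => _; [exact: pr|exact: ps].
have loads i : load n s' i = load n s i.
  have [im|mi] := leqP i m.
    by have /eqP := sumZ p i; rewrite eqZ // eqn_add2r => /eqP.
  have none (s1 : nat -> nat) : on_bins s1 -> load n s1 i = 0.
    move=> p1; rewrite /load big_pred0 // => j; apply/negP => /eqP e.
    by have := p1 j (ltn_ord j); rewrite e leqNgt mi.
  by rewrite !none.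
have rej' : rejw n s' <= rejw n s.
  have hs := sumZ w 0; rewrite /rejw.
  (* Jobs of [Z] that return to bin 0 have ratio at most a / b, those that leave it have ratio at
     least a / b, and the balance of [Z] at bin 0 gives both groups the same total processing
     time. *)
  suff h : \sum_(j in Z | ref j == 0) w j <= \sum_(j in Z | s j == 0) w j.
    by rewrite -(leq_add2r (\sum_(j in Z | s j == 0) w j)) hs leq_add2l.
  rewrite -(leq_pmul2r b0) !big_distrl /=.
  have dZ j : j \in Z -> ref j != s j by move/(subsetP sZ); rewrite inE.
  apply: (@leq_trans (\sum_(j in Z | ref j == 0) a * p j)).
    by apply: leq_sum => j /andP[_ /eqP]; apply: rej.
  rewrite -big_distrr /= eqZ // big_distrr /=.
  apply: leq_sum => j /andP[jZ /eqP sj]; apply: acc => //.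
  by have := dZ j jZ; rewrite sj.
have less : #|differ ref s'| < #|differ ref s|.
  apply: proper_card; apply/properP; split.
    apply/subsetP => j; rewrite !inE /s' inZE.
    by case: (boolP (j \in Z)) => //; rewrite eqxx.
  have [j jZ] := set0Pn _ Z0; exists j; first exact: (subsetP sZ).
  by rewrite inE /s' inZE jZ eqxx.
have [||s2 [p2 l2 r2 c2]] := IH s' _ ps'.
- exact: leq_trans less _.
- by move=> i im; rewrite loads; apply: close.
exists s2; split=> //; first by move=> i; rewrite l2 loads.
exact: leq_trans r2 rej'.
Qed.

End Schedules.

(** * The reference schedule *)

Section Greedy.

Variables (n V W : nat) (p w : nat -> nat).
Hypothesis p_le : forall j, j < n -> p j <= V.
Hypothesis w_le : forall j, j < n -> w j <= V.

(* [r] is the integer part of [w j * V ^ 2 / p j]. Distinct ratios differ by  *)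
(* at least 1 / V ^ 2, so jobs with the same key have the same ratio. Jobs    *)
(* with [p j = 0] have no key, hence are never rejected.                      *)
Definition at_key (r j : nat) : bool :=
  (r * p j <= w j * (V * V)) && (w j * (V * V) < r.+1 * p j).

(** Keys are scanned in increasing order, and all jobs in order for each key: [i] has a key below
    [r], or key [r] and index below [j]. Both tests fail if [p i = 0]. *)
Definition visited (r j i : nat) : bool :=
  (w i * (V * V) < r * p i) || (w i * (V * V) < r.+1 * p i) && (i < j).

Definition wsum (S : nat -> bool) := \sum_(i < n | S i) w i.
Definition psum (S : nat -> bool) := \sum_(i < n | S i) p i.

(* [k] is the first job that did not fit in the budget. *)
Definition blocked (S : nat -> bool) (k : nat) : Prop :=
  [/\ k < n, 0 < p k, ~~ S k, W < wsum S + w k &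
    (forall i, i < n -> S i -> w i * p k <= w k * p i) /\
    (forall i, i < n -> ~~ S i -> w k * p i <= w i * p k)].

Definition greedy_inv (r j : nat) (S : nat -> bool) (rem : nat) : Prop :=
  [/\ forall i, S i -> visited r j i, wsum S <= W &
    (wsum S + rem = W /\ forall i, i < n -> visited r j i -> S i)
    \/ (rem = 0 /\ exists k, blocked S k)].

(** If the ratio of [i] exceeded that of [k], it would do so by at least 1 / (p i * p k) >= 1 / V ^
    2. This is too much for two ratios which, multiplied by V ^ 2, are respectively below r + 1 and
    at least r. *)
Lemma key_le r i k : i < n -> k < n ->
  w i * (V * V) < r.+1 * p i -> r * p k <= w k * (V * V) ->
  w i * p k <= w k * p i.
Proof.
move=> iN kN hi hk; rewrite leqNgt; apply/negP => lt.
have h1 : (w k * p i).+1 * (V * V) <= w i * p k * (V * V) by rewrite leq_mul2r lt orbT.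
have h2 : p i * p k <= V * V by rewrite leq_mul ?p_le.
have [z|kpos] := posnP (p k); first by move: lt; rewrite z muln0.
have h3 : w i * (V * V) * p k < r.+1 * p i * p k by rewrite ltn_pmul2r.
have h4 : r * p k * p i <= w k * (V * V) * p i by rewrite leq_mul2r hk orbT.
have e1 : w i * p k * (V * V) = w i * (V * V) * p k by rewrite mulnAC.
have e2 : r.+1 * p i * p k = r * p k * p i + p i * p k by rewrite mulSn; lia.
have e3 : (w k * p i).+1 * (V * V) = w k * (V * V) * p i + V * V by rewrite mulSn; lia.
by lia.
Qed.

Lemma greedy0 : greedy_inv 0 0 (fun => false) W.
Proof.
split=> //; first by rewrite /wsum big_pred0.
left; rewrite /wsum big_pred0 //; split=> // i _; rewrite /visited.
by rewrite mul0n ltn0 /= ltn0 andbF.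
Qed.

Lemma eq_greedy r j r' j' (S : nat -> bool) rem :
  (forall i, i < n -> visited r j i = visited r' j' i) ->
  (forall i, S i -> i < n) -> greedy_inv r j S rem -> greedy_inv r' j' S rem.
Proof.
move=> e Sn [h1 h2 h3]; split=> //; first by move=> i Si; rewrite -e ?Sn ?h1.
case: h3 => [[h3 h4]|h3]; [left|by right].
by split=> // i iN vi; apply: h4; rewrite ?e.
Qed.

Lemma eq_greedyS r j (S S' : nat -> bool) rem :
  S =1 S' -> greedy_inv r j S rem -> greedy_inv r j S' rem.
Proof.
move=> e [h1 h2 h3]; have ew : wsum S = wsum S' by apply: eq_bigl => i; rewrite e.
split; [by move=> i; rewrite -e; exact: h1|by rewrite -ew|].
case: h3 => [[h3 h4]|[h3 [k [k1 k2 k3 k4 [k5 k6]]]]]; [left|right].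
  by rewrite -ew; split=> // i; rewrite -e; exact: h4.
split=> //; exists k; split; rewrite -?e -?ew //.
by split=> i; rewrite -e; [exact: k5|exact: k6].
Qed.

Lemma greedy_row r (S : nat -> bool) rem : (forall i, S i -> i < n) ->
  greedy_inv r n S rem -> greedy_inv r.+1 0 S rem.
Proof.
move=> Sn; apply: eq_greedy => // i iN; rewrite /visited iN ltn0 andbT andbF orbF.
by apply/orP/idP => [[h|//]|]; [rewrite mulSn; lia|right].
Qed.

Lemma greedy_skip r j (S : nat -> bool) rem : (forall i, S i -> i < n) -> ~~ at_key r j ->
  greedy_inv r j S rem -> greedy_inv r j.+1 S rem.
Proof.
move=> Sn nk; apply: eq_greedy => // i iN; rewrite /visited ltnS (leq_eqVlt i).
case: eqP => [->|//]; rewrite ltnn andbF orbF andbT.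
by move: nk; rewrite /at_key leqNgt; case: (_ < _); case: (_ < _).
Qed.

Lemma greedy_step r j S rem : j < n -> at_key r j ->
  greedy_inv r j S rem ->
  greedy_inv r j.+1 (fun i => S i || (w j <= rem) && (i == j)) (rem - w j).
Proof.
move=> jN /andP[k1 k2] [h1 h2 h3].
have jp : 0 < p j by case: (p j) k2 => // ; rewrite muln0.
have Sj : ~~ S j.
  by apply/negP => /h1; rewrite /visited ltnn andbF orbF ltnNge k1.
have vis i : visited r j i -> visited r j.+1 i.
  by rewrite /visited => /orP[->//|/andP[-> h]]; rewrite ltnS (ltnW h) orbT.
have visj : visited r j.+1 j by rewrite /visited ltnSn k2 orbT.
have visN i : visited r j.+1 i -> (i == j) || visited r j i.
  by rewrite /visited ltnS (leq_eqVlt i); case: (i == j).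
case: h3 => [[h3 h4]|[rem0 [k bl]]]; last first.
  (* With no budget left only a job of weight 0 could fit. Being outside [S], it would have at least
     the ratio of the blocked job, which is positive. *)
  have nw : (w j <= rem) = false.
    apply/negbTE; rewrite rem0 -ltnNge lt0n; apply/negP => /eqP wj.
    case: bl => _ pk _ lt [_ /(_ j jN Sj)].
    by rewrite wj mul0n leqn0 muln_eq0 => /orP[] /eqP; lia.
  apply: (@eq_greedyS _ _ S); first by move=> i; rewrite nw orbF.
  split=> //; first by move=> i /h1 /vis.
  by right; rewrite rem0; split=> //; exists k.
have [fit|nofit] := leqP (w j) rem.
  have ws : wsum (fun i => S i || (i == j)) = wsum S + w j.
    rewrite /wsum (bigD1 (Ordinal jN)) ?eqxx ?orbT //= addnC; congr (_ + _).
    apply: eq_bigl => i; rewrite -val_eqE /=.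
    by case: (eqVneq (i : nat) j) => [->|]; rewrite ?(negPf Sj) ?orbF ?andbT ?andbF.
  split.
  - by move=> i /= /orP[/h1/vis|/eqP->].
  - by rewrite /= ws; lia.
  - left; rewrite /= ws; split; first by lia.
    by move=> i iN /visN /orP[->|/(h4 _ iN) ->]; rewrite ?orbT.
apply: (@eq_greedyS _ _ S); first by move=> i; rewrite orbF.
split=> //; first by move=> i /h1 /vis.
right; split; first by lia.
exists j; split=> //; first by lia.
split=> i iN Si.
  apply: (@key_le r) => //; case/orP: (h1 _ Si) => [lt|/andP[//]].
  by rewrite mulSn; lia.
apply: (@key_le r) => //; rewrite leqNgt; apply: contra Si => lt.
by apply: h4 => //; rewrite /visited lt.
Qed.

(** Keys are at most V ^ 3, so all jobs with positive processing time have been visited. If a job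
    [k] was blocked, a / b is its ratio, and summing exchange inequalities over the jobs gives w k *
    (psum S' - psum S) <= p k * (wsum S' - wsum S) < p k * w k. *)
Lemma greedy_end S rem : greedy_inv (V * V * V).+1 0 S rem ->
  exists a b, [/\ 0 < b, forall i, i < n -> S i -> w i * b <= a * p i,
    forall i, i < n -> ~~ S i -> a * p i <= w i * b &
    forall S' : nat -> bool, wsum S' <= W -> psum S' <= psum S + V].
Proof.
case=> h1 h2 h3.
have visP i : i < n -> visited (V * V * V).+1 0 i = (0 < p i).
  move=> iN; rewrite /visited ltn0 andbF orbF.
  case: (p i) => [|q]; first by rewrite muln0 ltn0.
  have wi : w i * (V * V) <= V * (V * V) by rewrite leq_mul2r w_le ?orbT.
  apply/idP; apply: leq_trans (_ : (V * V * V).+1 <= _); last by rewrite leq_pmulr.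
  by rewrite ltnS -mulnA.
case: h3 => [[h3 h4]|[_ [k [kN pk Sk lt [k1 k2]]]]].
  (* Nothing was blocked: exactly the jobs with positive processing time are rejected, and their
     ratios are at most V. *)
  exists V, 1; split=> //.
  - move=> i iN Si; have := h1 i Si; rewrite visP // muln1 => pi.
    by apply: leq_trans (w_le iN) _; rewrite leq_pmulr.
  - move=> i iN Si; suff -> : p i = 0 by rewrite muln0.
    by apply/eqP; rewrite -leqn0 leqNgt -visP //; apply: contra Si; apply: h4.
  - move=> S' _; apply: leq_trans (leq_addr _ _).
    rewrite /psum big_mkcond [leqRHS]big_mkcond; apply: leq_sum => i _.
    case: ifP => // _; case: ifPn => // Si.
    by rewrite leqNgt -visP //; apply: contra Si; apply: h4.
exists (w k), (p k); split=> // S' fS'.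
apply: leq_trans (_ : psum S + p k <= _); last by rewrite leq_add2l p_le.
have wk0 : 0 < w k by lia.
rewrite -(leq_pmul2l wk0) leqNgt; apply/negP => gt.
pose a i := w k * p i.
pose b i := w i * p k.
have ab : \sum_(i < n | S' i) a i + \sum_(i < n | S i) b i
    <= \sum_(i < n | S' i) b i + \sum_(i < n | S i) a i.
  rewrite !(big_mkcond (fun i => S' _)) !(big_mkcond (fun i => S _)) -!big_split /=.
  apply: leq_sum => i _; case: (boolP (S i)) => Si; case: ifP => _;
    rewrite ?addn0 ?add0n // ?(addnC (a i)) //; [exact: k1|exact: k2].
move: ab; rewrite /a /b -!big_distrr -!big_distrl /= -/(psum _) -/(psum _).
rewrite -/(wsum _) -/(wsum _) => ab.
have lt' : wsum S' * p k < wsum S * p k + w k * p k.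
  by rewrite -mulnDl ltn_pmul2r //; lia.
by move: gt; rewrite mulnDr; lia.
Qed.

End Greedy.

(** * Closeness of total and prefix loads *)

Section Balance.

Variables (n m V : nat) (p c : nat -> nat) (ref s : nat -> nat).
Hypotheses (m_gt0 : 0 < m) (c_gt0 : forall i, 0 < i <= m -> 0 < c i).
Hypotheses (pref : on_bins n m ref) (ps : on_bins n m s).

Definition span (s : nat -> nat) : nat := \max_(i < m.+1) c i * load p n s i.

Hypothesis c0 : c 0 = 0.
Hypothesis balanced : forall i i', 0 < i <= m -> 0 < i' <= m ->
  c i * load p n ref i <= c i' * (load p n ref i' + V).

(** On a machine i, c i times the load of [s] is at most the span of [ref], attained at some i', and
    [balanced] compares i' with i. The lower bound follows from the equal total loads: what a bin
    lacks is spread over m other bins, each exceeding [ref] by at most V. *)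
Lemma balanced_close :
  span s <= span ref -> load p n s 0 <= load p n ref 0 + V ->
  forall i, i <= m ->
    load p n s i <= load p n ref i + m * V /\ load p n ref i <= load p n s i + m * V.
Proof.
move=> hs h0.
have up i : i <= m -> load p n s i <= load p n ref i + V.
  move=> im; case: (posnP i) => [->//|i0].
  have ci : 0 < c i by rewrite c_gt0 // i0.
  rewrite -(leq_pmul2l ci); apply: leq_trans (_ : span ref <= _).
    apply: leq_trans hs.
    exact: (leq_bigmax (F := fun i : 'I_m.+1 => c i * load p n s i) (Ordinal (im : i < m.+1))).
  apply/bigmax_leqP => i' _; case: (posnP i') => [->|i'0]; first by rewrite c0.
  by apply: balanced; rewrite ?i0 ?i'0 //= -ltnS.
move=> i im; split.
  by apply: leq_trans (up i im) _; rewrite leq_add2l leq_pmull.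
have im' : i < m.+1 by [].
have := sum_load p pref; rewrite -(sum_load p ps).
rewrite (bigD1 (Ordinal im')) //= [in RHS](bigD1 (Ordinal im')) //= => e.
have : \sum_(i' < m.+1 | i' != Ordinal im') load p n s i' <=
       \sum_(i' < m.+1 | i' != Ordinal im') (load p n ref i' + V).
  by apply: leq_sum => i' _; apply: up; rewrite -ltnS.
rewrite big_split /= sum_nat_const (eq_card (B := predC1 (Ordinal im'))) //.
rewrite cardC1 card_ord /= => h; move: e h.
by move: (\sum_(i0 | _) load p n ref _) (\sum_(i0 | _) load p n s _) => x y; lia.
Qed.

Lemma load_dist D k i : (forall j, j < n -> p j <= V) -> k <= n ->
  #|differ n ref s| <= D -> load p k s i <= load p k ref i + D * V.
Proof.
move=> pV kn dD; apply: leq_trans (_ : _ <= load p k ref i + #|differ n ref s| * V) _;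
  last by rewrite leq_add2l leq_mul2r dD orbT.
rewrite /load (big_ord_widen_cond n (fun j => s j == i) p kn).
rewrite (big_ord_widen_cond n (fun j => ref j == i) p kn).
rewrite -sum_nat_const [X in _ <= X + _]big_mkcond [X in _ <= _ + X]big_mkcond.
rewrite [leqLHS]big_mkcond -big_split /=; apply: leq_sum => j _.
rewrite inE; case: (eqVneq (ref j) (s j)) => [->|ne]; first by rewrite addn0.
case: ifP => _; last exact: leq0n.
by apply: leq_trans (leq_addl _ _); apply: pV.
Qed.

End Balance.

(** * The dynamic program *)

Section Digits.

Variable B : nat.
Hypothesis B_gt0 : 0 < B.

Definition digit (i x : nat) : nat := x %/ B ^ i %% B.

Definition encode (k : nat) (d : nat -> nat) : nat := \sum_(i < k) d i * B ^ i.

Definition put (d : nat -> nat) (i v : nat) : nat -> nat :=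
  fun x => if x == i then v else d x.

Lemma encodeS k d : encode k.+1 d = encode k d + d k * B ^ k.
Proof. by rewrite /encode big_ord_recr. Qed.

Lemma eq_encode k d d' : (forall i, i < k -> d i = d' i) -> encode k d = encode k d'.
Proof. by move=> e; apply: eq_bigr => i _; rewrite e. Qed.

Lemma encode_lt k d : (forall i, i < k -> d i < B) -> encode k d < B ^ k.
Proof.
elim: k => [|k IH] dB; first by rewrite /encode big_ord0.
rewrite encodeS expnS; apply: leq_trans (_ : B ^ k + d k * B ^ k <= _).
  by rewrite -addSn leq_add2r; apply: IH => i ik; apply: dB; exact: ltnW.
by rewrite -mulSn leq_mul2r dB ?orbT.
Qed.

Lemma digit_encode k d i :
  (forall i, i < k -> d i < B) -> i < k -> digit i (encode k d) = d i.
Proof.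
rewrite /digit; elim: k => // k IH dB; rewrite ltnS leq_eqVlt encodeS.
have dB' x : x < k -> d x < B by move=> xk; apply: dB; exact: ltnW.
case/predU1P => [->|ik].
  rewrite addnC divnMDl ?expn_gt0 ?B_gt0 // divn_small ?addn0 ?modn_small ?dB //.
  exact: encode_lt.
rewrite -[in d k * _](subnKC ik) expnD mulnA (mulnAC _ (B ^ i.+1)) expnSr mulnA addnC.
by rewrite mulnAC divnMDl ?expn_gt0 ?B_gt0 // modnMDl IH.
Qed.

Lemma encode_digit k x : x < B ^ k -> encode k (digit^~ x) = x.
Proof.
suff -> : encode k (digit^~ x) = x %% B ^ k by move=> h; rewrite modn_small.
elim: k => [|k IH]; first by rewrite /encode big_ord0 modn1.
rewrite encodeS IH {IH}.
have Bk : 0 < B ^ k by rewrite expn_gt0 B_gt0.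
have lt : x %% B ^ k + digit k x * B ^ k < B ^ k.+1.
  apply: leq_trans (_ : B ^ k + digit k x * B ^ k <= _).
    by rewrite -addSn leq_add2r ltn_mod.
  by rewrite -mulSn expnS leq_mul2r ltn_mod B_gt0 orbT.
rewrite -(modn_small lt); apply/eqP; rewrite eq_sym.
rewrite {1}(divn_eq x (B ^ k)) {1}(divn_eq (x %/ B ^ k) B).
by rewrite mulnDl -mulnA -expnS -addnA modnMDl addnC.
Qed.

Lemma encode_put k d i v : i < k ->
  encode k (put d i v) + d i * B ^ i = encode k d + v * B ^ i.
Proof.
move=> ik; rewrite /encode (bigD1 (Ordinal ik)) //= [in RHS](bigD1 (Ordinal ik)) //=.
rewrite /put eqxx.
set s1 := \sum_(_ < k | _) _; set s2 := \sum_(_ < k | _) _.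
have -> : s1 = s2 by apply: eq_bigr => x; rewrite -val_eqE /= => /negPf->.
by lia.
Qed.

Lemma encode_sub k d i q : i < k -> q <= d i ->
  encode k d - q * B ^ i = encode k (put d i (d i - q)).
Proof.
move=> ik qd; have := encode_put d (d i - q) ik.
by rewrite mulnBl; have := leq_mul qd (leqnn (B ^ i)); lia.
Qed.

Lemma encode_add k d i q : i < k ->
  encode k d + q * B ^ i = encode k (put d i (d i + q)).
Proof. by move=> ik; have := encode_put d (d i + q) ik; rewrite mulnDl; lia. Qed.

End Digits.

(** The state of zero deviation is the middle of the range, so the program finds it by one
    division. *)
Lemma encode_half M k : encode (M.*2.+1) k (fun => M) = (M.*2.+1 ^ k)./2.
Proof.
suff -> : M.*2.+1 ^ k = (encode M.*2.+1 k (fun => M)).*2.+1 by rewrite /= uphalf_double.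
elim: k => [|k IH]; first by rewrite /encode big_ord0.
rewrite encodeS expnS mulSn -doubleMl.
by move: IH; move: (encode _ k _) (_ ^ k) => x y; lia.
Qed.

(** Minimum capped by [bound], with its first argument, in the form of a left-to-right scan: this is
    the loop of the program, so ties and the default 0 agree. *)
Fixpoint sel (bound : nat) (f : nat -> nat) (k : nat) : nat * nat :=
  if k is k'.+1 then
    let r := sel bound f k' in if f k' < r.1 then (f k', k') else r
  else (bound, 0).

Lemma sel_le bound f k : (sel bound f k).1 <= bound.
Proof. by elim: k => //= k IH; case: ifP => //= /ltnW h; apply: leq_trans h IH. Qed.

Lemma sel_min bound f k i : i < k -> (sel bound f k).1 <= f i.
Proof.
elim: k => // k IH; rewrite ltnS leq_eqVlt /= => /predU1P ik.
case: ltnP => h /=; case: ik => [->|ik] //; last exact: IH.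
exact: leq_trans (ltnW h) (IH ik).
Qed.

Lemma sel_arg bound f k : (sel bound f k).1 < bound ->
  (sel bound f k).2 < k /\ f (sel bound f k).2 = (sel bound f k).1.
Proof.
elim: k => [|k IH] /=; first by rewrite ltnn.
by case: ifP => // _ /IH[h e]; split=> //; apply: ltnW.
Qed.

Lemma selS bound f k : sel bound f k.+1 =
  if f k < (sel bound f k).1 then (f k, k) else sel bound f k.
Proof. by []. Qed.

Arguments sel : simpl never.

(** * Recurrence, reconstruction and optimality *)

Section DynamicProgram.

Variables (n m V W M : nat) (p w ref : nat -> nat).
Hypothesis p_le : forall j, j < n -> p j <= V.
Hypothesis pref : on_bins n m ref.

Let B := M.*2.+1.
Let Ns := B ^ m.+1.

(* A state is a number in base B: its digit [i] is M plus the load of bin [i] *)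
(* minus its load in the reference schedule, bin 0 being the rejected jobs.   *)
(* The digits of [Ns./2] are all M. The value [W.+1] stands for infinity.     *)
Definition unload (j i x : nat) : nat := x - p j * B ^ i.
(** The state before job [j], if [x] is the state after [j] went to bin [i]: bin [i] loses [p j],
    and [ref j] regains what the reference put there. *)
Definition source (j i x : nat) : nat := unload j i x + p j * B ^ ref j.
(** No borrow at digit [i] and no carry at digit [ref j], so that integer arithmetic acts digit by
    digit. *)
Definition legal (j i x : nat) : bool :=
  (p j <= digit B i x) && (digit B (ref j) (unload j i x) + p j < B).

Definition cand (G : nat -> nat) (j x i : nat) : nat :=
  if legal j i x then G (source j i x) + (if i == 0 then w j else 0) else W.+1.

Fixpoint best (j : nat) : nat -> nat :=
  if j is j'.+1 then fun x => (sel W.+1 (cand (best j') j' x) m.+1).1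
  else fun x => if x == Ns./2 then 0 else W.+1.

Definition choice (j x : nat) : nat := (sel W.+1 (cand (best j) j x) m.+1).2.

Fixpoint trace (j x : nat) : nat -> nat :=
  if j is j'.+1 then
    fun y => if y == j' then choice j' x else trace j' (source j' (choice j' x) x) y
  else fun => 0.

Lemma source_encode d j i :
  (forall i, i < m.+1 -> d i < B) -> j < n -> i <= m -> legal j i (encode B m.+1 d) ->
  exists d', [/\ source j i (encode B m.+1 d) = encode B m.+1 d',
     forall i, i < m.+1 -> d' i < B &
     forall x, d' x + (if i == x then p j else 0) = d x + (if ref j == x then p j else 0)].
Proof.
move=> dB jn im; have rm := pref jn.
rewrite /legal /source /unload digit_encode // => /andP[pd].
rewrite encode_sub //.
set d1 := put d i _.
have d1B x : x < m.+1 -> d1 x < B.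
  by move=> xm; rewrite /d1 /put; have := dB _ xm; case: eqP => [->|]; lia.
rewrite digit_encode // encode_add // => pd'.
exists (put d1 (ref j) (d1 (ref j) + p j)); split=> //.
  by move=> x xm; rewrite {1}/put; case: eqP => // _; apply: d1B.
move=> x; rewrite {1}/put eq_sym.
case: (eqVneq (ref j) x) => [->|ne]; rewrite /d1 /put;
  case: (eqVneq i x) => [e|ne']; subst; rewrite ?eqxx; try lia.
all: by rewrite eq_sym (negPf ne'); lia.
Qed.

Lemma digit_ltB x i : i < m.+1 -> digit B i x < B.
Proof. by rewrite ltn_mod. Qed.

Lemma source_lt j i x : x < Ns -> j < n -> i <= m -> legal j i x -> source j i x < Ns.
Proof.
move=> xN jn im; rewrite -[x](@encode_digit B _ m.+1) // => lg.
have [|d' [-> d'B _]] := source_encode _ jn im lg; first by move=> y; apply: digit_ltB.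
exact: encode_lt.
Qed.

Lemma best_step j x : x < Ns -> j < n -> best j.+1 x <= W ->
  [/\ choice j x <= m, legal j (choice j x) x, source j (choice j x) x < Ns &
    best j (source j (choice j x) x) + (if choice j x == 0 then w j else 0) = best j.+1 x].
Proof.
move=> xN jn; rewrite /= -ltnS => hs; have := sel_arg hs.
rewrite -/(choice j x) ltnS => -[im ci]; move: hs; rewrite -ci ltnS /cand.
case: ifP => [lg _|]; last by rewrite ltnn.
by split=> //; apply: source_lt.
Qed.

Lemma trace_sound j x : j <= n -> x < Ns -> best j x <= W ->
  [/\ forall y, y < j -> trace j x y <= m, rejw w j (trace j x) = best j x &
    forall i, i <= m -> digit B i x + load p j ref i = M + load p j (trace j x) i].
Proof.
elim: j x => [|j IH] x jn xN.
  rewrite /=; case: eqP => [-> _|_]; last by rewrite ltnn.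
  split=> //; first by rewrite /rejw big_ord0.
  move=> i im; rewrite /load !big_ord0 /Ns -encode_half digit_encode //.
  by move=> *; rewrite /B; lia.
move=> xW; have [im lg sN eb] := best_step xN jn xW.
rewrite -eb in xW *; move: im lg sN xW {eb}; rewrite [trace _ _]/=.
move: (choice j x) => i0 im lg sN leW.
have [|t1 t2 t3] := IH _ (ltnW jn) sN; first by apply: leq_trans leW; apply: leq_addr.
have off y : y < j -> (if y == j then i0 else trace j (source j i0 x) y) = trace j (source j i0 x) y.
  by move=> yj; rewrite ltn_eqF.
split.
- by move=> y; case: eqP => // /eqP ne; rewrite ltnS leq_eqVlt (negPf ne) => /t1.
- by rewrite rejwS eqxx -t2; congr (_ + _); apply: eq_rejw.
move=> i im'; rewrite !loadS eqxx (eq_load _ _ off).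
have := @source_encode _ j i0 (digit_ltB x) jn im.
rewrite encode_digit // => /(_ lg) [d' [es d'B ed]].
by have := t3 i im'; rewrite es digit_encode //; have := ed i; lia.
Qed.

Definition deviation (s : nat -> nat) (k i : nat) : nat := M + load p k s i - load p k ref i.

(** The slack V keeps each move legal: a digit of at least V can give up [p k], and one of at most 2
    * M - V can receive it. *)
Lemma best_complete s k : on_bins n m s -> k <= n ->
  (forall k i, k <= n -> load p k s i + V <= load p k ref i + M /\
                         load p k ref i + V <= load p k s i + M) ->
  best k (encode B m.+1 (deviation s k)) <= rejw w k s.
Proof.
move=> ps kn near; elim: k kn => [|k IH] kn.
  rewrite /= /Ns -encode_half (@eq_encode _ _ _ (fun=> M)) ?eqxx //.
  by move=> i _; rewrite /deviation /load !big_ord0; lia.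
have [kW|Wk] := leqP (rejw w k.+1 s) W; last by apply: leq_trans (sel_le _ _ _) Wk.
have sm := ps k kn; have rm := pref kn; have pk := p_le kn.
apply: leq_trans (sel_min _ _ (sm : s k < m.+1)) _.
have devB i : i < m.+1 -> deviation s k.+1 i < B.
  by move=> im; have := near k.+1 i kn; rewrite /deviation /B; lia.
have lg : legal k (s k) (encode B m.+1 (deviation s k.+1)).
  have d1 : p k <= deviation s k.+1 (s k).
    by have := near k.+1 (s k) kn; rewrite /deviation; lia.
  rewrite /legal /unload digit_encode // d1 /= encode_sub // digit_encode //; last first.
    by move=> y ym; rewrite /put; have := devB _ ym; case: eqP => [->|]; lia.
  rewrite /put; have := near k.+1 (ref k) kn; rewrite /deviation /B.
  by case: eqP => [->|_]; lia.
rewrite /cand lg; have [d' [-> d'B ed]] := source_encode devB kn sm lg.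
rewrite rejwS leq_add2r (@eq_encode _ _ _ (deviation s k)) ?IH //; first exact: ltnW.
move=> i im; have := ed i; have := near k i (ltnW kn); have := near k.+1 i kn.
by rewrite /deviation !loadS; lia.
Qed.

Variable c : nat -> nat.

Definition state_span (x : nat) : nat :=
  \max_(i < m.+1) c i * (load p n ref i + digit B i x - M).

Lemma state_span_trace x : x < Ns -> best n x <= W ->
  state_span x = span n m p c (trace n x).
Proof.
move=> xN xW; have [_ _ t] := trace_sound (leqnn n) xN xW.
by apply: eq_bigr => i _; rewrite addnC t ?addKn // -ltnS.
Qed.

Hypotheses (m_gt0 : 0 < m) (c0 : c 0 = 0) (c_gt0 : forall i, 0 < i <= m -> 0 < c i).
Hypothesis balanced : forall i i', 0 < i <= m -> 0 < i' <= m ->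
  c i * load p n ref i <= c i' * (load p n ref i' + V).
Variables (a b : nat).
Hypotheses (b_gt0 : 0 < b) (ref_W : rejw w n ref <= W)
  (rejected_lo : forall j, j < n -> ref j = 0 -> w j * b <= a * p j)
  (accepted_hi : forall j, j < n -> ref j != 0 -> a * p j <= w j * b)
  (rejected_load : forall s, rejw w n s <= W -> load p n s 0 <= load p n ref 0 + V).
Hypothesis M_ge : ((m.+1 * (m * V)).+1 ^ m.+1).+1 * V <= M.

(** The states only see schedules near the reference. The reference is one of them, which settles
    every [s] of larger span. Any other [s] is close in load, and [proximity] replaces it by a
    schedule of equal span that [best_complete] covers. *)
Lemma trace_optimal x : x < Ns -> best n x <= W ->
  (forall y, y < Ns -> best n y <= W -> state_span x <= state_span y) ->
  forall s, on_bins n m s -> rejw w n s <= W ->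
    span n m p c (trace n x) <= span n m p c s.
Proof.
move=> xN xW xmin; rewrite -state_span_trace //.
have near_le s : on_bins n m s -> rejw w n s <= W ->
    (forall k i, k <= n -> load p k s i + V <= load p k ref i + M /\
                           load p k ref i + V <= load p k s i + M) ->
    state_span x <= span n m p c s.
  move=> ps sW near.
  have devB i : i < m.+1 -> deviation s n i < B.
    by move=> im; have := near n i (leqnn n); rewrite /deviation /B; lia.
  have := best_complete ps (leqnn n) near; set y := encode _ _ _ => yr.
  have yN : y < Ns by apply: encode_lt.
  have yW := leq_trans yr sW.
  apply: leq_trans (xmin y yN yW) _; apply/eq_leq; apply: eq_bigr => i _.
  rewrite /y digit_encode //; congr (_ * _).
  by have := near n i (leqnn n); rewrite /deviation; lia.
move=> s ps sW.
have V_M : V <= M by apply: leq_trans M_ge; rewrite leq_pmull.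
have refle : state_span x <= span n m p c ref.
  by apply: near_le => // k i _; rewrite addnC; lia.
have [le|gt] := leqP (span n m p c s) (span n m p c ref); last first.
  by apply: leq_trans refle (ltnW gt).
have close := balanced_close m_gt0 c_gt0 pref ps c0 balanced le (rejected_load sW).
have pK j : j < n -> p j <= m * V.
  by move=> jn; apply: leq_trans (p_le jn) _; rewrite leq_pmull.
have [|s' [ps' ls' rs' ds']] := proximity (w := w) b_gt0 rejected_lo accepted_hi pK pref ps.
  by move=> i /close[].
have <- : span n m p c s' = span n m p c s by apply: eq_bigr => i _; rewrite ls'.
apply: near_le => //; first exact: leq_trans rs' sW.
(* With D the proximity bound for K = m * V, prefix loads differ by at most D * V, and (D + 1) * V
   <= M leaves the slack V. *)
move=> k i kn.
have dist1 := load_dist i p_le kn (ltnW ds').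
have ds'' : #|differ n s' ref| < (m.+1 * (m * V)).+1 ^ m.+1.
  by rewrite (_ : differ n s' ref = differ n ref s') //; apply/setP => j; rewrite !inE eq_sym.
have dist2 := load_dist i p_le kn (ltnW ds'').
by move: M_ge; rewrite mulSn; lia.
Qed.

End DynamicProgram.

(** * Total correctness with running times *)

Section Machine.

Variables (H B : nat).
Hypothesis H_gt1 : 1 < H.
Hypothesis HB : H ^ 8 <= B.

Fixpoint value (s : memory) (e : expr) : nat :=
  match e with
  | Cst k => k
  | Get a e1 => s a (value s e1)
  | Op o e1 e2 => apply_op o (value s e1) (value s e2)
  end.

(* If all cells are at most H, an expression is at most H to this power. *)
Fixpoint degree (e : expr) : nat :=
  match e with
  | Cst _ | Get _ _ => 1
  | Op o e1 e2 =>
      match o with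
      | Add => (maxn (degree e1) (degree e2)).+1
      | Mul => degree e1 + degree e2
      | Defs.Sub | Div => degree e1
      | Eq | Lt => 1
      end
  end.

Fixpoint fits (e : expr) : bool :=
  match e with
  | Cst k => k <= H
  | Get _ e1 => (degree e1 <= 8) && fits e1
  | Op _ e1 e2 => [&& degree e1 <= 8, degree e2 <= 8, fits e1 & fits e2]
  end.

Definition bounded (s : memory) : Prop := forall a k, s a k <= H.

Lemma value_le s e : bounded s -> fits e -> value s e <= H ^ degree e.
Proof.
move=> bs; elim: e => [k|a e IH|o e1 IH1 e2 IH2] /=.
- by rewrite expn1.
- by rewrite expn1 => _; apply: bs.
case/and4P=> _ _ /IH1 {}IH1 /IH2 {}IH2.
case: o => /=.
- rewrite expnS; apply: leq_trans (_ : 2 * H ^ maxn (degree e1) (degree e2) <= _).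
    rewrite mul2n -addnn leq_add //.
    + by apply: leq_trans IH1 _; rewrite leq_pexp2l ?leq_maxl // ltnW.
    + by apply: leq_trans IH2 _; rewrite leq_pexp2l ?leq_maxr // ltnW.
  by rewrite leq_mul2r H_gt1 orbT.
- exact: leq_trans (leq_subr _ _) IH1.
- by rewrite expnD leq_mul.
- exact: leq_trans (leq_div _ _) IH1.
- by rewrite expn1 (leq_trans (leq_b1 _)) // ltnW.
- by rewrite expn1 (leq_trans (leq_b1 _)) // ltnW.
Qed.

(** Every subexpression has degree at most 8, and H ^ 8 fits in a word, so evaluation is never
    stuck. *)
Lemma eval_value s e :
  bounded s -> (degree e <= 8) && fits e -> eval B s e = Some (value s e).
Proof.
move=> bs.
have small e' : (degree e' <= 8) && fits e' -> word B (value s e') = Some (value s e').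
  case/andP=> d8 f; rewrite /word ifT //.
  apply: leq_trans HB; apply: leq_trans (value_le bs f) _.
  by rewrite leq_pexp2l // ltnW.
elim: e => [k|a e IH|o e1 IH1 e2 IH2] fe; first exact: (small (Cst k)).
  have := small _ fe; case/andP: fe => _ /= fe.
  by rewrite (IH fe).
have := small _ fe; case/andP: fe => _ /= /and4P[d1 d2 f1 f2].
by rewrite IH1 ?d1 // IH2 ?d2.
Qed.

Fixpoint mods (c : cmd) : seq nat :=
  match c with
  | Skip => [::]
  | Put a _ _ => [:: a]
  | Seq c1 c2 => mods c1 ++ mods c2
  | If _ c1 c2 => mods c1 ++ mods c2
  | While _ c => mods c
  end.

(** A frame condition: thanks to it, invariants only mention the banks that a command writes. *)
Definition same (L : seq nat) (s s' : memory) : Prop :=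
  forall a, a \notin L -> forall k, s' a k = s a k.

Lemma exec_same c s s' t : exec B c s s' t -> same (mods c) s s'.
Proof.
elim=> {c s s' t}.
- by [].
- by move=> s a e1 e2 k v _ _ a' /=; rewrite inE /update => /negPf-> k'.
- move=> c1 c2 s s1 s2 t1 t2 _ IH1 _ IH2 a /=.
  by rewrite mem_cat negb_or => /andP[h1 h2] k; rewrite IH2 // IH1.
- move=> e c1 c2 s s' v t _ _ _ IH a /=.
  by rewrite mem_cat negb_or => /andP[h1 h2] k; rewrite IH.
- move=> e c1 c2 s s' t _ _ IH a /=.
  by rewrite mem_cat negb_or => /andP[h1 h2] k; rewrite IH.
- by [].
- by move=> e c s s1 s2 v t1 t2 _ _ _ IH1 _ IH2 a h k; rewrite IH2 // IH1.
Qed.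

(** Total correctness within time at most [T]. Since [bounded] belongs to the contract, only
    assignments raise the question of overflow. *)
Definition wp (c : cmd) (T : nat) (s : memory) (Q : memory -> Prop) : Prop :=
  bounded s ->
  exists s' t, [/\ exec B c s s' t, t <= T, bounded s' & Q s'].

Lemma wp_imp c T T' s (Q Q' : memory -> Prop) :
  wp c T s Q -> T <= T' -> (forall s', bounded s' -> same (mods c) s s' -> Q s' -> Q' s') ->
  wp c T' s Q'.
Proof.
move=> h hT hQ bs; have [s' [t [e ht b q]]] := h bs.
exists s', t; split=> //; first exact: leq_trans ht hT.
exact: hQ b (exec_same e) q.
Qed.

Lemma wp_le c T T' s (Q : memory -> Prop) : wp c T s Q -> T <= T' -> wp c T' s Q.
Proof. by move=> h hT; apply: wp_imp h hT _. Qed.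

Lemma wp_skip s (Q : memory -> Prop) : Q s -> wp Skip 1 s Q.
Proof. by move=> q bs; exists s, 1; split=> //; apply: ExecSkip. Qed.

Lemma bounded_update s a k v : bounded s -> v <= H -> bounded (update s a k v).
Proof. by move=> bs hv a' k'; rewrite /update; case: ifP. Qed.

Definition fits1 e := (degree e <= 8) && fits e.

Lemma wp_put a e1 e2 s (Q : memory -> Prop) :
  fits1 e1 && fits1 e2 ->
  (bounded s -> value s e2 <= H) ->
  Q (update s a (value s e1) (value s e2)) ->
  wp (Put a e1 e2) (cost e1 + cost e2).+1 s Q.
Proof.
case/andP=> f1 f2 hv q bs.
eexists _, _; split; last exact: q; last by apply: bounded_update => //; exact: hv.
  by apply: ExecPut; apply: eval_value.
by [].
Qed.

Lemma wp_seq c1 c2 T1 T2 s (Q : memory -> Prop) :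
  wp c1 T1 s (fun s' => wp c2 T2 s' Q) -> wp (Seq c1 c2) (T1 + T2) s Q.
Proof.
move=> h bs; have [s1 [t1 [e1 h1 b1 q1]]] := h bs.
have [s2 [t2 [e2 h2 b2 q2]]] := q1 b1.
exists s2, (t1 + t2); split=> //; last exact: leq_add.
exact: ExecSeq e1 e2.
Qed.

Lemma wp_cut c1 c2 T1 T2 s (R Q : memory -> Prop) :
  wp c1 T1 s R ->
  (forall s', bounded s' -> same (mods c1) s s' -> R s' -> wp c2 T2 s' Q) ->
  wp (Seq c1 c2) (T1 + T2) s Q.
Proof. by move=> h1 h2; apply: wp_seq; apply: wp_imp h1 _ _. Qed.

Lemma wp_if e c1 c2 T1 T2 s (Q : memory -> Prop) :
  fits1 e ->
  (value s e != 0 -> wp c1 T1 s Q) -> (value s e = 0 -> wp c2 T2 s Q) ->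
  wp (If e c1 c2) (cost e + (T1 + T2)).+1 s Q.
Proof.
move=> fe h1 h2 bs; case: (eqVneq (value s e) 0) => [v0|vn0].
  have [s' [t [ex ht b q]]] := h2 v0 bs.
  exists s', (cost e + t).+1; split=> //; last by lia.
  by apply: ExecIfFalse ex; rewrite -v0; apply: eval_value.
have [s' [t [ex ht b q]]] := h1 vn0 bs.
exists s', (cost e + t).+1; split=> //; last by lia.
by apply: ExecIfTrue ex; [apply: eval_value|].
Qed.

Definition var x := Get x (Cst 0).
Definition set x e := Put x (Cst 0) e.
Definition for_ x e c :=
  Seq (set x (Cst 0))
      (While (Op Lt (var x) e) (Seq c (set x (Op Add (var x) (Cst 1))))).

(** The invariant for [k] is taken in the memory where the counter already equals [k]. The limit [e]
    must keep its value whatever the loop writes, and N <= H makes room for the final counter. *)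
Lemma wp_for x e c T N (Inv : nat -> memory -> Prop) s0 :
  x \notin mods c -> fits1 e && (N <= H) ->
  (forall s, same (x :: mods c) s0 s -> value s e = N) ->
  Inv 0 (update s0 x 0 0) ->
  (forall k s, k < N -> bounded s -> same (x :: mods c) s0 s -> s x 0 = k -> Inv k s ->
     wp c T s (fun s' => Inv k.+1 (update s' x 0 k.+1))) ->
  wp (for_ x e c) (N * (T + cost e + 10) + cost e + 10) s0
    (fun s' => Inv N s' /\ same (x :: mods c) s0 s').
Proof.
move=> xc /andP[fe NH] vale inv0 body bs.
have fL : fits1 (Op Lt (var x) e).
  by case/andP: fe => d f; rewrite /fits1 /= d f.
have f0 : fits1 (Cst 0) by [].
have f1 : fits1 (Op Add (var x) (Cst 1)) by rewrite /fits1 /=; lia.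
have loop d : forall k s, k + d = N -> bounded s -> same (x :: mods c) s0 s ->
    s x 0 = k -> Inv k s -> exists s' t,
    [/\ exec B (While (Op Lt (var x) e) (Seq c (set x (Op Add (var x) (Cst 1))))) s s' t,
        t <= d * (T + cost e + 10) + cost e + 4, bounded s' &
        Inv N s' /\ same (x :: mods c) s0 s'].
  elim: d => [|d IH] k s kd bds sm sx inv.
    exists s, (cost (Op Lt (var x) e)).+1; split=> //.
    - apply: ExecWhileFalse; rewrite eval_value // (_ : value _ _ = 0) //=.
      by rewrite vale // sx -kd addn0 ltnn.
    - by rewrite /=; lia.
    - by split=> //; rewrite -kd addn0.
  have kN : k < N by lia.
  have [s1 [t1 [ex1 ht1 b1 inv1]]] := body k s kN bds sm sx inv bds.
  have sm1 := exec_same ex1.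
  have s1x : s1 x 0 = k by rewrite sm1.
  set s2 := update s1 x 0 k.+1.
  have b2 : bounded s2 by apply: bounded_update => //; lia.
  have sm2 : same (x :: mods c) s0 s2.
    move=> a; rewrite inE negb_or => /andP[ax ac] k'.
    rewrite /s2 /update (negPf ax) /= sm1 // sm //.
    by rewrite inE negb_or ax ac.
  have s2x : s2 x 0 = k.+1 by rewrite /s2 /update !eqxx.
  have [s3 [t3 [ex3 ht3 b3 inv3]]] := IH k.+1 s2 ltac:(lia) b2 sm2 s2x inv1.
  have exset : exec B (set x (Op Add (var x) (Cst 1))) s1 s2 6.
    have -> : s2 = update s1 x (value s1 (Cst 0)) (value s1 (Op Add (var x) (Cst 1))).
      by rewrite /= s1x addn1.
    have -> : 6 = (cost (Cst 0) + cost (Op Add (var x) (Cst 1))).+1 by [].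
    by apply: ExecPut; apply: eval_value.
  exists s3, (cost (Op Lt (var x) e) + (t1 + 6) + t3).+1; split=> //.
    apply: ExecWhileTrue (eval_value bds fL) _ (ExecSeq ex1 exset) ex3.
    by rewrite /= vale // sx kN.
  by rewrite /= mulSn; lia.
have [||||s' [t [ex ht b q]]] := loop N 0 (update s0 x 0 0) (add0n _).
- exact: bounded_update.
- move=> a; rewrite inE negb_or => /andP[ax ac] k'.
  by rewrite /update (negPf ax).
- by rewrite /update !eqxx.
- exact: inv0.
exists s', (3 + t); split=> //; last by lia.
apply: ExecSeq ex; apply: (@ExecPut B s0 x (Cst 0) (Cst 0) 0 0);
  exact: (@eval_value s0 (Cst 0)).
Qed.

End Machine.

(** * The program *)

Local Notation add := (Op Add).
Local Notation sub := (Op Defs.Sub).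
Local Notation mul := (Op Mul).
Local Notation div := (Op Div).
Local Notation eqv := (Op Eq).
Local Notation lt := (Op Lt).

(* Scalar variables are the cells 0 of their banks. Arrays indexed by bins    *)
(* use 0 for rejection and [i.+1] for the machine [i], as the output does.    *)
Local Notation bPtime := 1 (only parsing).
Local Notation bWeight := 2 (only parsing).
Local Notation bNum := 3 (only parsing).
Local Notation bDen := 4 (only parsing).
Local Notation bOut := 5 (only parsing).
Local Notation bV := 6 (only parsing).
Local Notation bJ := 7 (only parsing).
Local Notation bX := 8 (only parsing).
Local Notation bI := 9 (only parsing).
Local Notation bRem := 10 (only parsing).
Local Notation bRej := 11 (only parsing).
Local Notation bRef := 12 (only parsing).
Local Notation bLoad := 13 (only parsing).
Local Notation bCoef := 14 (only parsing).
Local Notation bQ := 15 (only parsing).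
Local Notation bM := 16 (only parsing).
Local Notation bPow := 17 (only parsing).
Local Notation bVal := 18 (only parsing).
Local Notation bCh := 19 (only parsing).
Local Notation bBest := 20 (only parsing).
Local Notation bArg := 21 (only parsing).
Local Notation bTmp := 22 (only parsing).
Local Notation bCur := 23 (only parsing).
Local Notation bSpan := 24 (only parsing).

Local Notation eN := (Get 0 (Cst 0)).
Local Notation eW := (Get 0 (Cst 1)).

Definition max_prog : cmd :=
  for_ bJ eN
    (Seq (If (lt (var bV) (Get bPtime (var bJ))) (set bV (Get bPtime (var bJ))) Skip)
         (If (lt (var bV) (Get bWeight (var bJ))) (set bV (Get bWeight (var bJ))) Skip)).

Definition coef_prog (m : nat) : cmd :=
  Seq (set bQ (Cst 1))
 (Seq (for_ bI (Cst m) (set bQ (mul (var bQ) (Get bNum (var bI)))))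
      (for_ bI (Cst m)
        (Put bCoef (add (var bI) (Cst 1))
           (mul (Get bDen (var bI)) (div (var bQ) (Get bNum (var bI))))))).

Definition pow_prog (m : nat) : cmd :=
  Seq (set bM (Cst 1))
 (Seq (for_ bI (Cst m.+2) (set bM (mul (var bM) (mul (Cst (m.+1 * m.+1)) (add (var bV) (Cst 1))))))
 (Seq (set bPow (Cst 1))
      (for_ bI (Cst m.+1)
        (Put bPow (add (var bI) (Cst 1))
           (mul (Get bPow (var bI)) (add (mul (Cst 2) (var bM)) (Cst 1))))))).

(* Once a job does not fit, the truncated subtraction leaves no budget, so    *)
(* that no further job is rejected: those of weight 0 have been seen before.  *)
Definition greedy_prog : cmd :=
  Seq (set bRem eW)
      (for_ bX (add (mul (mul (var bV) (var bV)) (var bV)) (Cst 1))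
        (for_ bJ eN
          (If (mul (lt (mul (var bX) (Get bPtime (var bJ)))
                       (add (mul (Get bWeight (var bJ)) (mul (var bV) (var bV))) (Cst 1)))
                   (lt (mul (Get bWeight (var bJ)) (mul (var bV) (var bV)))
                       (mul (add (var bX) (Cst 1)) (Get bPtime (var bJ)))))
              (Seq (If (lt (var bRem) (Get bWeight (var bJ))) Skip (Put bRej (var bJ) (Cst 1)))
                   (set bRem (sub (var bRem) (Get bWeight (var bJ)))))
              Skip))).

Definition balance_prog (m : nat) : cmd :=
  for_ bJ eN
    (Seq (set bArg (Cst 0))
    (Seq (If (Get bRej (var bJ)) Skip
           (Seq (set bArg (Cst 1))
             (for_ bI (Cst m)
               (If (lt (mul (Get bCoef (add (var bI) (Cst 1)))
                            (add (Get bLoad (add (var bI) (Cst 1))) (Get bPtime (var bJ))))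
                       (mul (Get bCoef (var bArg))
                            (add (Get bLoad (var bArg)) (Get bPtime (var bJ)))))
                   (set bArg (add (var bI) (Cst 1)))
                   Skip))))
    (Seq (Put bRef (var bJ) (var bArg))
         (Put bLoad (var bArg) (add (Get bLoad (var bArg)) (Get bPtime (var bJ))))))).

Local Notation eB := (Get bPow (Cst 1)).

(** The remainder of y modulo B, computed as y - (y / B) * B. *)
Definition digit_expr (i x : expr) : expr :=
  sub (div x (Get bPow i)) (mul (div (div x (Get bPow i)) eB) eB).

Definition cell_prog (m : nat) : cmd :=
  let p := Get bPtime (var bJ) in
  let r := Get bRef (var bJ) in
  for_ bI (Cst m.+1)
    (If (lt p (add (digit_expr (var bI) (var bX)) (Cst 1)))
      (Seq (set bTmp (sub (var bX) (mul p (Get bPow (var bI)))))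
           (If (lt (add (digit_expr r (var bTmp)) p) eB)
             (Seq (set bTmp
                     (add (Get bVal (add (mul (var bJ) (Get bPow (Cst m.+1)))
                                         (add (var bTmp) (mul p (Get bPow r)))))
                          (mul (eqv (var bI) (Cst 0)) (Get bWeight (var bJ)))))
                  (If (lt (var bTmp) (var bBest))
                    (Seq (set bBest (var bTmp)) (set bArg (var bI)))
                    Skip))
             Skip))
      Skip).

(** The n + 1 layers lie one after the other in [bVal], layer j at offset j * Ns; [bCh] holds the
    choices for the n jobs in the same way. *)
Definition dp_prog (m : nat) : cmd :=
  let eNs := Get bPow (Cst m.+1) in
  Seq (for_ bX eNs (Put bVal (var bX) (add eW (Cst 1))))
 (Seq (Put bVal (div eNs (Cst 2)) (Cst 0))
      (for_ bJ eN (for_ bX eNs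
        (Seq (set bBest (add eW (Cst 1)))
        (Seq (set bArg (Cst 0))
        (Seq (cell_prog m)
        (Seq (Put bVal (add (mul (add (var bJ) (Cst 1)) eNs) (var bX)) (var bBest))
             (Put bCh (add (mul (var bJ) eNs) (var bX)) (var bArg))))))))).

(* [bBest] holds the best span found plus 1, and 0 as long as there is none. *)
Definition pick_prog (m : nat) : cmd :=
  let eNs := Get bPow (Cst m.+1) in
  Seq (set bBest (Cst 0))
      (for_ bX eNs
        (If (lt (Get bVal (add (mul eN eNs) (var bX))) (add eW (Cst 1)))
          (Seq (set bSpan (Cst 0))
          (Seq
            (for_ bI (Cst m.+1)
              (Seq (set bTmp (mul (Get bCoef (var bI))
                     (sub (add (Get bLoad (var bI)) (digit_expr (var bI) (var bX))) (var bM))))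
                   (If (lt (var bSpan) (var bTmp)) (set bSpan (var bTmp)) Skip)))
            (If (add (eqv (var bBest) (Cst 0)) (lt (add (var bSpan) (Cst 1)) (var bBest)))
              (Seq (set bBest (add (var bSpan) (Cst 1))) (set bCur (var bX)))
              Skip)))
          Skip)).

(** The counter of [for_] only grows, so step x treats job n - 1 - x. *)
Definition back_prog (m : nat) : cmd :=
  let p := Get bPtime (var bJ) in
  for_ bX eN
    (Seq (set bJ (sub (sub eN (Cst 1)) (var bX)))
    (Seq (Put bOut (var bJ)
           (Get bCh (add (mul (var bJ) (Get bPow (Cst m.+1))) (var bCur))))
         (set bCur (add (sub (var bCur) (mul p (Get bPow (Get bOut (var bJ)))))
                        (mul p (Get bPow (Get bRef (var bJ)))))))).

Definition main_prog (m : nat) : cmd :=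
  Seq max_prog (Seq (coef_prog m) (Seq (pow_prog m) (Seq greedy_prog
    (Seq (balance_prog m) (Seq (dp_prog m) (Seq (pick_prog m) (back_prog m))))))).

(** * Correctness and cost of each phase *)

Section Verification.

Variables (H Bw : nat).
Hypothesis H_gt1 : 1 < H.
Hypothesis HBw : H ^ 8 <= Bw.

Local Notation wp := (wp H Bw).

Ltac fits := rewrite /digit_expr /fits1 /= ?leq_max; lia.
Ltac upd := rewrite /update /=.
Ltac wpfor T N Inv :=
  apply: (@wp_for _ _ H_gt1 HBw _ _ _ T N Inv);
  [ by [] | fits | let sm := fresh in intros ? sm; rewrite /= ?sm // | upd | ].
Ltac wpput := apply: (wp_put H_gt1 HBw); [fits | rewrite /update /= => ? | upd].
Ltac wpif := apply: (wp_if H_gt1 HBw); [fits | move=> /= | move=> /= ].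

Section Program.

Variables (n m W : nat) (p w num den : nat -> nat).
Hypothesis m_H : (m.+2) ^ 2 <= H.
Hypothesis n_H : n <= H.

Definition maxpw := \max_(j < n) maxn (p j) (w j).

Lemma ptime_maxpw j : j < n -> p j <= maxpw.
Proof.
move=> jn; apply: leq_trans (leq_maxl _ (w j)) _.
exact: (leq_bigmax (F := fun j : 'I_n => maxn (p j) (w j)) (Ordinal jn)).
Qed.

Lemma weight_maxpw j : j < n -> w j <= maxpw.
Proof.
move=> jn; apply: leq_trans (leq_maxr (p j) _) _.
exact: (leq_bigmax (F := fun j : 'I_n => maxn (p j) (w j)) (Ordinal jn)).
Qed.

Lemma max_spec s : s 0 0 = n -> (forall j, s bPtime j = p j) ->
  (forall j, s bWeight j = w j) -> s bV 0 = 0 ->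
  wp max_prog (n * 100 + 20) s (fun s' => s' bV 0 = maxpw).
Proof.
move=> sn sp sw s0.
apply: wp_imp.
- wpfor 50 n (fun k s' => s' bV 0 = \max_(j < k) maxn (p j) (w j)).
    by rewrite big_ord0.
  move=> k s1 kn b1 sm sk inv; rewrite /= in sm.
  have p1 : s1 bPtime k = p k by rewrite sm.
  have w1 : s1 bWeight k = w k by rewrite sm.
  apply: wp_le.
  + apply: (@wp_cut _ _ _ _ _ _ _ (fun s' => s' bV 0 = maxn (s1 bV 0) (p k))).
      wpif; rewrite sk p1 => c.
        wpput; first exact: b1.
        by rewrite sk p1; move: c; lia.
      by apply: wp_skip; move: c; lia.
    move=> s2 b2 sm2 v2.
    have sk2 : s2 bJ 0 = k by rewrite sm2.
    have w2 : s2 bWeight k = w k by rewrite sm2.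
    wpif; rewrite sk2 w2 v2 => c.
      wpput; first exact: b2.
      by rewrite sk2 w2 big_ord_recr /= -inv; move: c; lia.
    by apply: wp_skip; upd; rewrite big_ord_recr /= -inv v2; move: c; lia.
  + by [].
- by rewrite /=; lia.
- by move=> s' _ _ [h _].
Qed.

(* The inverse of the speed, multiplied by the numerators of all the speeds. *)
Definition coef (i : nat) : nat :=
  if i is i'.+1 then den i' * ((\prod_(x < m) num x) %/ num i') else 0.

Hypothesis prod_H : forall k, k <= m -> \prod_(x < k) num x <= H.
Hypothesis coef_H : forall i, i <= m -> coef i <= H.

Lemma coef_spec s : (forall i, s bNum i = num i) -> (forall i, s bDen i = den i) ->
  s bCoef 0 = 0 ->
  wp (coef_prog m) (m * 100 + 50) s (fun s' => forall i, i <= m -> s' bCoef i = coef i).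
Proof.
move=> sn sd s0.
apply: wp_le.
- apply: wp_seq; wpput; first by lia.
  apply: wp_cut.
    wpfor 10 m (fun k s' => s' bQ 0 = \prod_(x < k) num x).
      by rewrite big_ord0.
    move=> k s1 km b1 sm sk inv.
    have e : s1 bQ 0 * s1 bNum (s1 bI 0) = \prod_(x < k.+1) num x.
      by rewrite sk (sm bNum) // /update /= sn inv big_ord_recr.
    apply: wp_le; [wpput|by []].
      by rewrite e prod_H.
    by rewrite e.
  move=> s1 b1 _ [Q1 sm1].
  apply: wp_imp; [wpfor 20 m (fun k s' => forall i, i <= k -> s' bCoef i = coef i)|exact: leqnn|by move=> s' _ _ [h _]].
    by move=> i; rewrite leqn0 => /eqP->; rewrite sm1.
  move=> k s2 km b2 sm sk inv.
  have e : s2 bDen (s2 bI 0) * (s2 bQ 0 %/ s2 bNum (s2 bI 0)) = coef k.+1.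
    by rewrite sk (sm bDen) // (sm bQ) // (sm bNum) // (sm1 bDen) // (sm1 bNum) // Q1 /update /= sn sd.
  apply: wp_le; [wpput|by []].
    by rewrite e coef_H.
  rewrite e sk addn1 => i; rewrite leq_eqVlt ltnS.
  by case: eqP => [->//|_]; apply: inv.
- by rewrite /=; lia.
Qed.

Let V := maxpw.
(* The (m+1)-st power bounds the number of jobs treated differently from the  *)
(* reference; each of them moves a load by at most V.                         *)
Definition radius : nat := (m.+1 * m.+1 * V.+1) ^ m.+2.
Let M := radius.
Let B := M.*2.+1.
Let Ns := B ^ m.+1.
Hypothesis radius_H : M <= H.
Hypothesis Ns_H : Ns <= H.

Lemma pow_spec s : s bV 0 = V ->
  wp (pow_prog m) (m * 100 + 200) s
    (fun s' => s' bM 0 = M /\ forall i, i <= m.+1 -> s' bPow i = B ^ i).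
Proof.
move=> sV.
have base0 : 0 < m.+1 * m.+1 * V.+1 by rewrite !muln_gt0.
apply: wp_le.
- apply: wp_seq; wpput; first by lia.
  apply: wp_cut.
    wpfor 20 m.+2 (fun k s' => s' bM 0 = (m.+1 * m.+1 * V.+1) ^ k).
      by [].
    move=> k s1 km b1 sm sk inv.
    have e : s1 bM 0 * (m.+1 * m.+1 * (s1 bV 0 + 1)) = (m.+1 * m.+1 * V.+1) ^ k.+1.
      by rewrite (sm bV) // /update /= sV inv expnS mulnC addn1.
    apply: wp_le; [wpput|by []].
      by rewrite e; apply: leq_trans radius_H; rewrite leq_pexp2l.
    by rewrite e.
  move=> s1 b1 _ [M1 sm1]; have M1' : s1 bM 0 = M by [].
  apply: wp_seq; wpput; first by lia.
  apply: wp_imp; [wpfor 25 m.+1 (fun k s' => forall i, i <= k -> s' bPow i = B ^ i)|exact: leqnn|].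
  3: by move=> s' _ _ [h sm]; split=> //; rewrite sm // /update /= M1.
    by move=> i; rewrite leqn0 => /eqP->.
  move=> k s2 km b2 sm sk inv.
  have e : s2 bPow (s2 bI 0) * (2 * s2 bM 0 + 1) = B ^ k.+1.
    by rewrite sk inv // (sm bM) //= /update /= M1' expnSr mul2n addn1.
  apply: wp_le; [wpput|by []].
    by rewrite e; apply: leq_trans Ns_H; apply: leq_pexp2l; rewrite /B.
  rewrite e sk addn1 => i; rewrite leq_eqVlt ltnS.
  by case: eqP => [->//|_]; apply: inv.
- by rewrite /=; lia.
Qed.

Hypothesis W_H : W < H.
Hypothesis V3_H : (V * V * V).+1 <= H.
Hypothesis m_gt0 : 0 < m.
Hypothesis load_H : \sum_(j < n) p j <= H.

Lemma greedy_spec s : s 0 0 = n -> s 0 1 = W -> (forall j, s bPtime j = p j) ->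
  (forall j, s bWeight j = w j) -> s bV 0 = V -> (forall i, s bRej i = 0) ->
  wp greedy_prog (V.+1 ^ 3 * (n * 100 + 100) + 100) s
    (fun s' => exists rem,
       greedy_inv n V W p w (V * V * V).+1 0 (fun i => s' bRej i != 0) rem).
Proof.
move=> sn sW sp sw sV sR.
pose inv r j (s' : memory) := greedy_inv n V W p w r j (fun i => s' bRej i != 0) (s' bRem 0)
  /\ (forall i, s' bRej i != 0 -> i < n).
have p_le := ptime_maxpw.
apply: wp_le.
- apply: wp_seq; wpput; first by rewrite sW ltnW.
  apply: wp_imp; [wpfor (n * 95 + 40) (V * V * V).+1 (fun r s' => inv r 0 s')|exact: leqnn|].
  4: by move=> s' _ _ [[h _] _]; exists (s' bRem 0).
  + by rewrite /update /= !sV addn1.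
  + split=> /=; last by move=> i; rewrite /update /= sR.
    rewrite /update /= sW; apply: eq_greedyS (greedy0 _ _ _ _ _) => i.
    by rewrite sR.
  move=> r s1 rV b1 sm1 sr1 inv1.
  apply: wp_imp; [wpfor 75 n (fun j s' => inv r j s')|rewrite /=; lia|].
  + by rewrite (sm1 0).
  + exact: inv1.
  2: by move=> s' _ _ [[h1 h2] _]; split; [exact: greedy_row h2 h1|exact: h2].
  move=> j s2 jn b2 sm2 sj2 [inv2 inv2'].
  have e1 : s2 bPtime (s2 bJ 0) = p j by rewrite sj2 (sm2 bPtime) // (sm1 bPtime) // /update /= sp.
  have e2 : s2 bWeight (s2 bJ 0) = w j by rewrite sj2 (sm2 bWeight) // (sm1 bWeight) // /update /= sw.
  have e3 : s2 bX 0 = r by rewrite (sm2 bX).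
  have e4 : s2 bV 0 = V by rewrite (sm2 bV) // (sm1 bV) // /update /= sV.
  apply: wp_le.
  + wpif; rewrite e1 e2 e3 e4 !addn1 mulnb ltnS -/(at_key V p w r j) => key.
      have {}key : at_key V p w r j by move: key; case: at_key.
      apply: (@wp_cut _ _ _ _ _ _ _ (fun s' => forall i,
        (s' bRej i != 0) = (s2 bRej i != 0) || (w j <= s2 bRem 0) && (i == j))).
        wpif; rewrite e2 => c.
          apply: wp_skip => i; have -> : (w j <= s2 bRem 0) = false by move: c; lia.
          by rewrite orbF.
        have {}c : w j <= s2 bRem 0 by move: c; lia.
        wpput; first by lia.
        by move=> i; rewrite sj2 c /=; case: (i == j); rewrite ?orbT ?orbF.
      move=> s3 b3 sm3 rej3.
      have f2 : s3 bWeight (s3 bJ 0) = w j by rewrite (sm3 bWeight) // (sm3 bJ) // e2.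
      have f3 : s3 bRem 0 = s2 bRem 0 by rewrite (sm3 bRem).
      wpput; first by apply: leq_trans (leq_subr _ _) _; apply: b3.
      split=> [|i] /=; upd.
        rewrite f2 f3; apply: eq_greedyS (greedy_step p_le jn key inv2) => i.
        by rewrite rej3.
      by rewrite rej3 => /orP[/inv2'//|/andP[_ /eqP->]].
    have {}key : ~~ at_key V p w r j by move: key; case: at_key.
    by apply: wp_skip; split; upd => //; apply: greedy_skip.
  + by [].
- rewrite /=; have -> : V.+1 ^ 3 = (V * V * V).+1 + (3 * V * V + 3 * V) by rewrite !expnS; lia.
  lia.
Qed.

(** The chosen machine b minimises c b * (L b + p k), so its new weighted load is at most c i' * (L
    i' + p k) for every machine i', and p k <= V. This preserves the comparison of all pairs of
    machines. *)
Lemma balance_spec s (rej : nat -> bool) : s 0 0 = n -> (forall j, s bPtime j = p j) ->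
  (forall i, i <= m -> s bCoef i = coef i) ->
  (forall i, (s bRej i != 0) = rej i) -> (forall i, s bLoad i = 0) ->
  wp (balance_prog m) (n * (m * 100 + 100) + 100) s
    (fun s' => [/\ on_bins n m (s' bRef), forall j, j < n -> (s' bRef j == 0) = rej j,
      forall i, s' bLoad i = load p n (s' bRef) i &
      forall i i', 0 < i <= m -> 0 < i' <= m ->
        coef i * load p n (s' bRef) i <= coef i' * (load p n (s' bRef) i' + V)]).
Proof.
move=> sn sp sc sR sL.
have p_le := ptime_maxpw.
pose inv k (s' : memory) := [/\ on_bins k m (s' bRef),
  forall j, j < k -> (s' bRef j == 0) = rej j,
  forall i, s' bLoad i = load p k (s' bRef) i &
      forall i i', 0 < i <= m -> 0 < i' <= m ->
        coef i * load p k (s' bRef) i <= coef i' * (load p k (s' bRef) i' + V)].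
apply: wp_imp; [wpfor (m * 90 + 80) n inv| rewrite /=; lia|by move=> s' _ _ []].
  split=> //; upd; first by move=> i; rewrite /load big_ord0.
  by move=> i i' _ _; rewrite /load big_ord0 muln0.
move=> k s1 kn b1 sm1 sk1 [pr1 rj1 ld1 bal1].
have e1 : s1 bPtime k = p k by rewrite (sm1 bPtime).
have e2 : (s1 bRej k != 0) = rej k by rewrite (sm1 bRej) // sR.
have e3 i : i <= m -> s1 bCoef i = coef i by move=> im; rewrite (sm1 bCoef) // sc.
pose L i := load p k (s1 bRef) i.
apply: wp_le.
- apply: wp_seq; wpput; first by lia.
  apply: (@wp_cut _ _ _ _ _ _ _ (fun s' => let b := s' bArg 0 in
    [/\ b <= m, (b == 0) = rej k & ~~ rej k -> forall i, 0 < i <= m ->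
       coef b * (L b + p k) <= coef i * (L i + p k)])).
    wpif; upd; rewrite sk1.
      by move=> r; apply: wp_skip; rewrite -e2 r.
    move=> r; have {}r : rej k = false by rewrite -e2 r.
    apply: wp_seq; wpput; first by lia.
    apply: wp_imp; [wpfor 40 m (fun x (s' : memory) =>
      0 < s' bArg 0 <= m /\ forall i, 0 < i <= x ->
       coef (s' bArg 0) * (L (s' bArg 0) + p k) <= coef i * (L i + p k))|exact: leqnn|].
      3: by move=> s' _ _ [[/andP[h1 h2] h3] _]; rewrite r eqn0Ngt h1; split.
    + by rewrite m_gt0; split=> // i; case: i.
    move=> x s2 xm b2 sm2 sx2 [/andP[h1 h2] h3].
    have f1 : s2 bPtime (s2 bJ 0) = p k.
      by rewrite (sm2 bPtime) // (sm2 bJ) //; upd; rewrite sk1 e1.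
    have f2 i : i <= m -> s2 bCoef i = coef i.
      by move=> im; rewrite (sm2 bCoef) //; upd; rewrite e3.
    have f3 i : s2 bLoad i = L i by rewrite (sm2 bLoad) //; upd; rewrite ld1.
    apply: wp_le.
    + wpif; rewrite sx2 f1 !f3 !f2 // ?addn1 // => c.
        wpput; rewrite sx2 addn1; first by lia.
        split=> //.
        move=> i /andP[i0]; rewrite leq_eqVlt ltnS => /predU1P[->//|ix].
        by apply: leq_trans (h3 i _); [move: c; lia|rewrite i0].
      apply: wp_skip; upd; split; first by rewrite h1.
      move=> i /andP[i0]; rewrite leq_eqVlt ltnS => /predU1P[->|ix].
        by move: c; lia.
      by apply: h3; rewrite i0.
    + by [].
  move=> s2 b2 sm2 [h1 h2 h3]; rewrite /= in sm2.
  have f1 : s2 bPtime k = p k by rewrite (sm2 bPtime).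
  have f2 i : s2 bLoad i = L i by rewrite (sm2 bLoad) //; upd; rewrite ld1.
  have f3 : s2 bJ 0 = k by rewrite (sm2 bJ).
  have f4 x : s2 bRef x = s1 bRef x by rewrite (sm2 bRef).
  apply: wp_seq; wpput; first exact: b2.
  set b := s2 bArg 0 in h1 h2 h3 *.
  have ldk i : load p k.+1 (fun x => if x == k then b else s2 bRef x) i =
      L i + (if b == i then p k else 0).
    rewrite loadS eqxx; congr (_ + _); apply: eq_load => j jk.
    by rewrite ltn_eqF // f4.
  wpput.
    rewrite f2 f3 f1 -/b; apply: leq_trans load_H.
    have -> : L b + p k = load p k.+1 (fun x => if x == k then b else s2 bRef x) b.
      by rewrite ldk eqxx.
    rewrite /load (big_ord_widen_cond n (fun j => (if j == k then b else s2 bRef j) == b) p kn).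
    by rewrite [leqLHS]big_mkcond leq_sum // => j _; case: ifP.
  rewrite f2 f3 f1 -/b.
  split; upd.
  - move=> x; rewrite ltnS leq_eqVlt; case: eqP => [->|_] //= xk.
    by rewrite f4 pr1.
  - move=> x; rewrite ltnS leq_eqVlt; case: eqP => [->|_] //= xk.
    by rewrite f4 rj1.
  - by move=> i; rewrite ldk f2 eq_sym; case: eqP => [->|]; rewrite ?addn0.
  - move=> i i' im i'm; rewrite !ldk.
    have bal := bal1 i i' im i'm; rewrite -/(L _) -/(L i') in bal.
    case: (b =P i) => [ebi|_]; last first.
      rewrite addn0; apply: leq_trans bal _; rewrite leq_mul2l; apply/orP; right; lia.
    have nr : ~~ rej k by rewrite -h2 ebi -lt0n; case/andP: im.
    case: (b =P i') => [ebi'|_].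
      rewrite -ebi -ebi' leq_mul2l; apply/orP; right; lia.
    rewrite addn0 -ebi; apply: leq_trans (h3 nr i' i'm) _.
    by rewrite leq_mul2l leq_add2l p_le ?orbT.
- rewrite /=; lia.
Qed.
End Program.

(** * Filling the table, choosing a final state, tracing back *)

Section Table.

Variables (n m W V M : nat) (p w ref c : nat -> nat).
Hypothesis m_H : m.+2 <= H.
Hypothesis n_H : n <= H.
Hypothesis w_le : forall j, j < n -> w j <= V.
Hypothesis pref : on_bins n m ref.

Let B := M.*2.+1.
Let Ns := B ^ m.+1.
Hypothesis Ns_H : Ns <= H.
Hypothesis WV_H : W.+1 + V <= H.
Hypothesis span_H : forall i, i <= m -> c i * (\sum_(j < n) p j + M.*2) < H.

Local Notation best := (best m W M p w ref).
Local Notation choice := (choice m W M p w ref).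

Record ready (s : memory) : Prop := Ready {
  ready_n : s 0 0 = n;
  ready_W : s 0 1 = W;
  ready_p : forall j, s bPtime j = p j;
  ready_w : forall j, s bWeight j = w j;
  ready_ref : forall j, s bRef j = ref j;
  ready_pow : forall i, i <= m.+1 -> s bPow i = B ^ i
}.

Lemma ready_same L s s' : same L s s' ->
  all (fun a => a \notin L) [:: 0; bPtime; bWeight; bRef; bPow] -> ready s -> ready s'.
Proof.
move=> sm /= /and5P[h0 h1 h2 h3 /andP[h4 _]] [r1 r2 r3 r4 r5 r6].
split; first [by rewrite sm | by move=> j; rewrite sm | by move=> i hi; rewrite sm // r6].
Qed.

Lemma digitE i x : x %/ B ^ i - x %/ B ^ i %/ B * B = digit B i x.
Proof. by rewrite /digit; set y := _ %/ _; rewrite {1}(divn_eq y B) addKn. Qed.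

Lemma ready_pow1 s : ready s -> s bPow 1 = B.
Proof. by move=> rd; rewrite (ready_pow rd) ?expn1. Qed.

Definition table_val (s : memory) (t : nat) : Prop :=
  forall u, u < t -> s bVal u = best (u %/ Ns) (u %% Ns).
Definition table_ch (s : memory) (t : nat) : Prop :=
  forall u, u < t -> s bCh u = choice (u %/ Ns) (u %% Ns).

Lemma Ns_gt0 : 0 < Ns. Proof. by rewrite expn_gt0. Qed.

Lemma divNs j x : x < Ns -> (j * Ns + x) %/ Ns = j.
Proof. by move=> xN; rewrite divnMDl ?Ns_gt0 // divn_small ?addn0. Qed.

Lemma modNs j x : x < Ns -> (j * Ns + x) %% Ns = x.
Proof. by move=> xN; rewrite modnMDl modn_small. Qed.

Lemma ltNs j j' x : x < Ns -> j < j' -> j * Ns + x < j' * Ns.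
Proof.
move=> xN jj; apply: leq_trans (_ : j.+1 * Ns <= _); last by rewrite leq_mul2r jj orbT.
by rewrite mulSn addnC ltn_add2r.
Qed.

(** The program skips illegal bins. This agrees with [sel], as their candidate value W + 1 is never
    below the current minimum. *)
Lemma cell_spec s j x : ready s -> j < n -> x < Ns ->
  s bJ 0 = j -> s bX 0 = x -> table_val s (j.+1 * Ns) ->
  s bBest 0 = W.+1 -> s bArg 0 = 0 ->
  wp (cell_prog m)
    (m.+1 * 150 + 50) s
    (fun s' => s' bBest 0 = best j.+1 x /\ s' bArg 0 = choice j x).
Proof.
move=> rd jn xN sJ sX tv sB sA.
apply: wp_imp; [wpfor 120 m.+1 (fun k (s' : memory) =>
  (s' bBest 0, s' bArg 0) = sel W.+1 (cand W M p w ref (best j) j x) k)|rewrite /=; lia|].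
- by rewrite sB sA.
2: by move=> s' _ _ [h _]; rewrite /choice /= -h.
move=> i s1 im b1 sm1 si inv1; rewrite /= in sm1.
have rd1 : ready s1 by apply: ready_same sm1 _ rd.
have e1 : s1 bJ 0 = j by rewrite (sm1 bJ).
have e2 : s1 bX 0 = x by rewrite (sm1 bX).
have rm := pref jn.
have selE : sel W.+1 (cand W M p w ref (best j) j x) i.+1 =
  if cand W M p w ref (best j) j x i < s1 bBest 0
  then (cand W M p w ref (best j) j x i, i) else (s1 bBest 0, s1 bArg 0).
  by rewrite selS -inv1.
have bW : s1 bBest 0 <= W.+1 by rewrite -[s1 bBest 0]/((s1 bBest 0, s1 bArg 0).1) inv1 sel_le.
have illegal : legal M p ref j i x = false ->
    (s1 bBest 0, s1 bArg 0) = sel W.+1 (cand W M p w ref (best j) j x) i.+1.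
  by move=> nl; rewrite selE /cand nl ltnNge bW.
apply: wp_le.
- have pw1 := ready_pow1 rd1.
  have pwi : s1 bPow i = B ^ i by rewrite (ready_pow rd1) // ltnW.
  have p1 := ready_p rd1 j.
  wpif; rewrite e1 e2 si p1 pwi pw1 digitE addn1 ltnS => c1; last first.
    apply: wp_skip; upd; apply: illegal; rewrite /legal; move: c1.
    by case: (p j <= _).
  have {}c1 : p j <= digit B i x by move: c1; case: (p j <= _).
  apply: wp_seq; wpput; rewrite e1 e2 si p1 pwi.
    by apply: leq_trans (leq_subr _ _) _; rewrite -e2.
  rewrite -/(unload M p j i x); match goal with |- wp _ _ ?s _ => set s2 := s end.
  have [f1 f3 f4 f5] : [/\ s2 bJ 0 = j, s2 bI 0 = i, s2 bTmp 0 = unload M p j i x &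
    s2 bBest 0 = s1 bBest 0 /\ s2 bArg 0 = s1 bArg 0] by [].
  have f6 y : s2 bVal y = s1 bVal y by [].
  have rd2 : ready s2 by case: rd1.
  move: (s2) f1 f3 f4 f5 f6 rd2 => {}s2 f1 f3 f4 [f5 f5'] f6 rd2.
  have pw1' := ready_pow1 rd2.
  have pwN : s2 bPow m.+1 = Ns by rewrite (ready_pow rd2).
  have pwr : s2 bPow (ref j) = B ^ ref j by rewrite (ready_pow rd2) // leqW.
  have p2 := ready_p rd2 j.
  have w2 := ready_w rd2 j.
  have r2 := ready_ref rd2 j.
  wpif; rewrite f1 r2 p2 pwr pw1' f4 digitE => c2; last first.
    apply: wp_skip; rewrite f5 f5'; apply: illegal; rewrite /legal; move: c2.
    by case: (_ + _ < _); rewrite ?andbF.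
  have {}c2 : digit B (ref j) (unload M p j i x) + p j < B.
    by move: c2; case: (_ + _ < _).
  have lg : legal M p ref j i x by rewrite /legal c1 c2.
  have sN := source_lt pref xN jn im lg.
  have ev : s1 bVal (j * Ns + source M p ref j i x) = best j (source M p ref j i x).
    rewrite (sm1 bVal) // tv ?ltNs //.
    by rewrite divNs // modNs.
  have ec : best j (source M p ref j i x) + (i == 0) * w j = cand W M p w ref (best j) j x i.
    by rewrite /cand lg; case: (i == 0); rewrite ?mul1n ?mul0n.
  have bj y : best j y <= W.+1.
    by case: (j) => [|j']; [rewrite /=; case: ifP | apply: sel_le].
  apply: wp_seq; wpput; rewrite f1 f3 r2 p2 w2 pwN pwr f4 -/(source M p ref j i x) f6 ev ec.
    rewrite -ec; apply: leq_trans WV_H; rewrite leq_add ?bj //.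
    by case: (i == 0); rewrite ?mul1n ?mul0n // w_le.
  wpif; rewrite f5 => c3.
    apply: wp_seq; apply: (wp_put H_gt1 HBw); [fits|by move=> bd; apply: (bd bTmp 0)|upd].
    wpput; first by rewrite f3; lia.
    by rewrite selE f3 ifT //; move: c3; case: (_ < _).
  apply: wp_skip; upd; rewrite f5 f5' selE ifF //; move: c3; case: (_ < _) => //.
- by [].
Qed.
Lemma dp_spec s : ready s ->
  wp (dp_prog m) (n.+1 * (Ns * (m.+1 * 150 + 200) + 100)) s
    (fun s' => table_val s' (n.+1 * Ns) /\ table_ch s' (n * Ns)).
Proof.
move=> rd.
have pwN s' : ready s' -> s' bPow m.+1 = Ns by move=> rd'; rewrite (ready_pow rd').
apply: wp_le.
- apply: wp_cut.
    wpfor 20 Ns (fun k (s' : memory) => forall u, u < k -> s' bVal u = W.+1).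
    + exact: pwN.
    + by [].
    move=> k s1 kN b1 sm1 sk inv1; rewrite /= in sm1.
    apply: wp_le; [wpput|by []]; rewrite (sm1 0) // /update /= (ready_W rd) addn1; first by lia.
    move=> u; rewrite ltnS leq_eqVlt sk; case: eqP => //= _; exact: inv1.
  move=> s1 b1 _ [v1 sm1]; rewrite /= in sm1.
  have rd1 : ready s1 by apply: ready_same sm1 _ rd.
  apply: wp_seq; wpput; first by [].
  rewrite pwN // divn2; match goal with |- wp _ _ ?s _ => set s2 := s end.
  have rd2 : ready s2 by case: rd1.
  have tv2 : table_val s2 Ns.
    move=> u uN; rewrite divn_small // modn_small // /s2 /= v1 //.
  apply: wp_imp; [wpfor (Ns * (m.+1 * 150 + 180) + 50) n (fun j (s' : memory) =>
    table_val s' (j.+1 * Ns) /\ table_ch s' (j * Ns))|exact: leqnn|].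
  4: by move=> s' _ _ [h _].
  + exact: (ready_n rd2).
  + by split; [rewrite mul1n; exact: tv2|rewrite mul0n].
  move=> j s3 jn b3 sm3 sj3 [tv3 tc3]; rewrite /= in sm3.
  have rd3 : ready s3 by apply: ready_same sm3 _ rd2.
  apply: wp_imp; [wpfor (m.+1 * 150 + 160) Ns (fun x (s' : memory) =>
    table_val s' (j.+1 * Ns + x) /\ table_ch s' (j * Ns + x))|rewrite /=; lia|].
  + exact: pwN.
  + by rewrite !addn0.
  2: by move=> s' _ _ [[h1 h2] _]; split; [rewrite mulSn addnC; exact: h1|rewrite mulSn addnC; exact: h2].
  move=> x s4 xN b4 sm4 sx4 [tv4 tc4]; rewrite /= in sm4.
  have rd4 : ready s4 by apply: ready_same sm4 _ rd3.
  have sj4 : s4 bJ 0 = j by rewrite (sm4 bJ).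
  apply: wp_le.
  + apply: wp_seq; wpput; rewrite (ready_W rd4) addn1; first by lia.
    apply: wp_seq; wpput; first by [].
    match goal with |- wp _ _ ?s _ => set s5 := s end.
    have rd5 : ready s5 by case: rd4.
    apply: wp_cut; first apply: (@cell_spec s5 j x rd5 jn xN) => //.
      by move=> u hu; apply: tv4; rewrite ltn_addr.
    move=> s6 b6 sm6 [best6 choice6]; rewrite /= in sm6.
    have rd6 : ready s6 by apply: ready_same sm6 _ rd5.
    have v6 u : s6 bVal u = s4 bVal u by rewrite (sm6 bVal).
    have h6 u : s6 bCh u = s4 bCh u by rewrite (sm6 bCh).
    have sj6 : s6 bJ 0 = j by rewrite (sm6 bJ).
    have sx6 : s6 bX 0 = x by rewrite (sm6 bX).
    apply: wp_seq; wpput; first exact: b6.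
    wpput; first exact: b6.
    rewrite sj6 sx6 pwN // best6 choice6 addn1; split=> u; upd; rewrite addnS ltnS leq_eqVlt.
      by case: eqP => [->|_ /= hu]; [rewrite divNs // modNs|rewrite v6 tv4].
    by case: eqP => [->|_ /= hu]; [rewrite divNs // modNs|rewrite h6 tc4].
  + rewrite /=; lia.
- rewrite /=; lia.
Qed.

Local Notation state_span := (state_span n m M p ref c).

(** The existence of a finite final state rules out the value 0 of [bBest] at the end. *)
Lemma pick_spec s : ready s -> table_val s (n.+1 * Ns) ->
  s bM 0 = M -> (forall i, i <= m -> s bCoef i = c i) ->
  (forall i, s bLoad i = load p n ref i) ->
  (exists2 x, x < Ns & best n x <= W) ->
  wp (pick_prog m) (Ns * (m.+1 * 150 + 200) + 100) s
    (fun s' => [/\ s' bCur 0 < Ns, best n (s' bCur 0) <= W &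
       forall y, y < Ns -> best n y <= W -> state_span (s' bCur 0) <= state_span y]).
Proof.
move=> rd tv sM sc sL [x0 x0N x0W].
have pwN s' : ready s' -> s' bPow m.+1 = Ns by move=> rd'; rewrite (ready_pow rd').
have span_lt i x : i <= m -> c i * (load p n ref i + digit B i x - M) < H.
  move=> im; apply: leq_ltn_trans (span_H im); rewrite leq_mul2l; apply/orP; right.
  apply: leq_trans (leq_subr _ _) _; apply: leq_add; last by rewrite -ltnS ltn_mod.
  by rewrite /load big_mkcond; apply: leq_sum => j _; case: ifP.
apply: wp_le.
- apply: wp_seq; wpput; first by [].
  apply: wp_imp; [wpfor (m.+1 * 120 + 180) Ns (fun k (s' : memory) =>
     (s' bBest 0 = 0 -> forall y, y < k -> W < best n y) /\
     (s' bBest 0 != 0 -> [/\ s' bCur 0 < Ns, best n (s' bCur 0) <= W,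
        s' bBest 0 = (state_span (s' bCur 0)).+1 &
        forall y, y < k -> best n y <= W -> state_span (s' bCur 0) <= state_span y]))|exact: leqnn|].
  4: { move=> s' _ _ [[h1 h2] _]; case: (eqVneq (s' bBest 0) 0) => [/h1 h|/h2[]] //.
       by have := h _ x0N; rewrite ltnNge x0W. }
  + exact: pwN.
  + by [].
  move=> x s1 xN b1 sm1 sx1 [inv1 inv1']; rewrite /= in sm1.
  have rd1 : ready s1.
    by apply: ready_same sm1 _ _ => //; case: rd.
  have M1 : s1 bM 0 = M by rewrite (sm1 bM).
  have c1 i : i <= m -> s1 bCoef i = c i by move=> im; rewrite (sm1 bCoef) // /update /= sc.
  have L1 i : s1 bLoad i = load p n ref i by rewrite (sm1 bLoad) // /update /= sL.
  have v1 : s1 bVal (n * Ns + x) = best n x.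
    by rewrite (sm1 bVal) // /update /= tv ?ltNs // divNs // modNs.
  apply: wp_le.
  + wpif; rewrite (ready_n rd1) (ready_W rd1) sx1 pwN // v1 addn1 ltnS => fx; last first.
      have {}fx : W < best n x by move: fx; case: leqP.
      apply: wp_skip; split=> /= h.
        by move=> y; rewrite ltnS leq_eqVlt => /predU1P[->//|]; apply: inv1.
      have [i1 i2 i3 i4] := inv1' h; split=> // y; rewrite ltnS leq_eqVlt.
      by case/predU1P => [->|]; [rewrite leqNgt fx|apply: i4].
    have {}fx : best n x <= W by move: fx; case: leqP.
    apply: wp_seq; wpput; first by [].
    apply: (@wp_cut _ _ _ _ _ _ _ (fun s' => s' bSpan 0 = state_span x)).
      apply: wp_imp; [wpfor 100 m.+1 (fun k (s' : memory) =>
         s' bSpan 0 = \max_(i < k) c i * (load p n ref i + digit B i x - M))|exact: leqnn|].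
      3: by move=> s' _ _ [].
      * by rewrite big_ord0.
      move=> i s2 im b2 sm2 si2 inv2; rewrite /= in sm2.
      have rd2 : ready s2 by apply: ready_same sm2 _ _ => //; case: rd1.
      have e1 : s2 bCoef i = c i by rewrite (sm2 bCoef) // /update /= c1.
      have e2 : s2 bLoad i = load p n ref i by rewrite (sm2 bLoad) // /update /= L1.
      have e3 : s2 bX 0 = x by rewrite (sm2 bX).
      have e4 : s2 bM 0 = M by rewrite (sm2 bM).
      have e5 : s2 bPow i = B ^ i by rewrite (ready_pow rd2) // ltnW.
      have e6 := ready_pow1 rd2.
      have lti := span_lt i x im.
      apply: wp_le.
      * apply: wp_seq; wpput; rewrite si2 e1 e2 e3 e4 e5 e6 digitE; first exact: ltnW.
        wpif; rewrite inv2 => c3.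
          wpput; first exact: ltnW.
          by rewrite big_ord_recr /=; move: c3; case: ltnP => // h _; rewrite (maxn_idPr (ltnW h)).
        by apply: wp_skip; upd; rewrite inv2 big_ord_recr /=; move: c3; case: ltnP => // h _; rewrite (maxn_idPl h).
      * by rewrite /=; lia.
    move=> s2 b2 sm2 sp2; rewrite /= in sm2.
    have e1 : s2 bBest 0 = s1 bBest 0 by rewrite (sm2 bBest).
    have e2 : s2 bX 0 = x by rewrite (sm2 bX).
    have e3 : s2 bCur 0 = s1 bCur 0 by rewrite (sm2 bCur).
    have spH : state_span x < H.
      have -> : H = H.-1.+1 by case: (H) H_gt1.
      rewrite ltnS; apply/bigmax_leqP => i _; have := span_lt i x (ltn_ord i : i <= m).
      by case: (H).
    wpif; rewrite e1 sp2 addn1 => c2.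
      apply: wp_seq; wpput; rewrite sp2 addn1 //.
      wpput; rewrite e2; first by apply: leq_trans Ns_H; apply: ltnW.
      split=> //= _; split=> // y; rewrite ltnS leq_eqVlt => /predU1P[->//|yx yW].
      case: (eqVneq (s1 bBest 0) 0) => [h|h]; first by have := inv1 h y yx; rewrite ltnNge yW.
      have [i1 i2 i3 i4] := inv1' h; apply: leq_trans (i4 y yx yW).
      by move: c2; rewrite (negPf h) i3 add0n ltnS; lia.
    have c3 : s1 bBest 0 != 0 by move: c2; case: eqP.
    have [i1 i2 i3 i4] := inv1' c3.
    apply: wp_skip; split; upd; rewrite e1 ?e3 => h; first by rewrite h in c3.
    split=> // y; rewrite ltnS leq_eqVlt => /predU1P[-> _|]; last exact: i4.
    by move: c2; rewrite (negPf c3) add0n i3 ltnS; case: leqP => //; lia.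
  + rewrite /=; lia.
- rewrite /=; lia.
Qed.

Local Notation trace := (trace m W M p w ref).

Lemma back_spec s : ready s -> table_ch s (n * Ns) ->
  s bCur 0 < Ns -> best n (s bCur 0) <= W ->
  wp (back_prog m) (n * 100 + 50) s
    (fun s' => forall j, j < n -> s' bOut j = trace n (s bCur 0) j).
Proof.
move=> rd tc; set x := s bCur 0 => xN xW.
have pwN s' : ready s' -> s' bPow m.+1 = Ns by move=> rd'; rewrite (ready_pow rd').
(* After k steps the jobs from n - k on are written out, and the rest of the trace is the trace from
   the current state. *)
apply: wp_imp; [wpfor 80 n (fun k (s' : memory) =>
  [/\ s' bCur 0 < Ns, best (n - k) (s' bCur 0) <= W & forall y, y < n ->
     trace n x y = if y < n - k then trace (n - k) (s' bCur 0) y else s' bOut y])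
  |rewrite /=; lia|].
4: by move=> s' _ _ [[_ _ h] _] j jn; rewrite h // subnn.
- exact: (ready_n rd).
- by rewrite subn0; split=> // y ->.
move=> k s1 kn b1 sm1 sk1 [x1N x1W out1]; rewrite /= in sm1.
have rd1 : ready s1 by apply: ready_same sm1 _ rd.
have jn : n - k.+1 < n by lia.
have jE : n - k = (n - k.+1).+1 by lia.
have J : n - 1 - k = n - k.+1 by lia.
rewrite jE in x1W out1; move: (n - k.+1) jn J {jE} x1W out1 => j jn J x1W out1.
have ch1 : s1 bCh (j * Ns + s1 bCur 0) = choice j (s1 bCur 0).
  by rewrite (sm1 bCh) // /update /= tc ?ltNs // divNs // modNs.
have [im lg sN eb] := best_step pref x1N jn x1W.
have rm := pref jn.
have pwi i : i <= m -> s1 bPow i = B ^ i by move=> h; rewrite (ready_pow rd1) // leqW.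
apply: wp_le.
- apply: wp_seq; wpput; rewrite (ready_n rd1) sk1 J; first by lia.
  apply: wp_seq; wpput; rewrite pwN // ch1.
  wpput; rewrite eqxx (ready_p rd1) (ready_ref rd1) !pwi // -/(unload M p j _ _) -/(source M p ref j _ _).
    by apply: leq_trans Ns_H; apply: ltnW.
  split; upd => //.
    by apply: leq_trans x1W; rewrite -eb leq_addr.
  move=> y yn; rewrite out1 // ltnS leq_eqVlt.
  case: (eqVneq y j) => [->|ne] /=; first by rewrite ltnn eqxx.
  by rewrite (negPf ne).
- by rewrite /=; lia.
Qed.

End Table.

(** * Composition of the phases *)

Section Main.

Variables (n m W : nat) (p w num den : nat -> nat).
Local Notation V := (maxpw n p w).
Local Notation M := (radius n m p w).
Local Notation Ns := (M.*2.+1 ^ m.+1).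
Local Notation c := (coef m num den).

(** One summand for each phase of [main_prog], in order. *)
Definition running_time : nat :=
  (n * 100 + 20) + ((m * 100 + 50) + ((m * 100 + 200) +
  ((V.+1 ^ 3 * (n * 100 + 100) + 100) + ((n * (m * 100 + 100) + 100) +
  (n.+1 * (Ns * (m.+1 * 150 + 200) + 100) + ((Ns * (m.+1 * 150 + 200) + 100) +
  (n * 100 + 50))))))).

Hypotheses (m_H : m.+2 ^ 2 <= H) (n_H : n <= H).
Hypothesis prod_H : forall k, k <= m -> \prod_(x < k) num x <= H.
Hypothesis coef_H : forall i, i <= m -> c i <= H.
Hypotheses (M_H : M <= H) (Ns_H : Ns <= H) (W_H : W < H).
Hypothesis V3_H : (V * V * V).+1 <= H.
Hypothesis load_H : \sum_(j < n) p j <= H.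
Hypothesis WV_H : W.+1 + V <= H.
Hypothesis span_H : forall i, i <= m -> c i * (\sum_(j < n) p j + M.*2) < H.
Hypothesis m_gt0 : 0 < m.
Hypothesis num_gt0 : forall i, i < m -> 0 < num i.
Hypothesis den_gt0 : forall i, i < m -> 0 < den i.

Lemma coef_gt0 i : 0 < i <= m -> 0 < c i.
Proof.
case: i => // i /= im; rewrite muln_gt0 den_gt0 //=.
have prod_gt0 : 0 < \prod_(x < m) num x by apply: prodn_gt0 => x; apply: num_gt0.
rewrite divn_gt0 ?num_gt0 // dvdn_leq //.
by rewrite (bigD1 (Ordinal im)) //= dvdn_mulr.
Qed.

(** With X = (m + 1) ^ 2 * (V + 1) and A the proximity bound, A <= X ^ (m + 1) and 2 * V <= X, hence
    (A + 1) * V <= A * (2 * V) <= X ^ (m + 2). *)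
Lemma radius_ge : ((m.+1 * (m * V)).+1 ^ m.+1).+1 * V <= M.
Proof.
rewrite /radius -/V; set X := m.+1 * m.+1 * V.+1.
have h1 : (m.+1 * (m * V)).+1 <= X by rewrite /X; nia.
have h2 : V.*2 <= X by rewrite /X; nia.
rewrite [leqRHS]expnSr; set A := (m.+1 * (m * V)).+1 ^ m.+1.
have A0 : 0 < A by rewrite expn_gt0.
have h3 : A <= X ^ m.+1 by rewrite leq_exp2r.
apply: leq_trans (_ : A * V.*2 <= _); last exact: leq_mul.
by rewrite -addnn mulnDr mulSn leq_add2r leq_pmull.
Qed.

Lemma main_spec s : s 0 0 = n -> s 0 1 = W ->
  (forall j, s 1 j = p j) -> (forall j, s 2 j = w j) ->
  (forall i, s 3 i = num i) -> (forall i, s 4 i = den i) ->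
  (forall a k, 4 < a -> s a k = 0) ->
  wp (main_prog m) running_time s (fun s' =>
    [/\ on_bins n m (s' 5), rejw w n (s' 5) <= W &
      forall t, on_bins n m t -> rejw w n t <= W ->
        span n m p c (s' 5) <= span n m p c t]).
Proof.
move=> sn sW sp sw snum sden s0.
have p_le := @ptime_maxpw n p w.
have w_le := @weight_maxpw n p w.
apply: wp_cut; first by apply: (@max_spec n m p w) => //; rewrite s0.
move=> s1 _ sm1 V1; rewrite /= in sm1.
have z1 a k : 6 < a -> 7 < a -> s1 a k = 0.
  by move=> h h'; rewrite sm1 ?s0 // ?inE; lia.
apply: wp_cut.
  by apply: (@coef_spec n m num den) => //; [move=> i; rewrite sm1|move=> i; rewrite sm1|rewrite z1].
move=> s2 _ sm2 c2; rewrite /= in sm2.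
apply: wp_cut.
  by apply: (@pow_spec n m p w) => //; rewrite sm2.
move=> s3 _ sm3 [M3 pw3]; rewrite /= in sm3.
apply: wp_cut.
  apply: (@greedy_spec n m W p w) => //.
  - by rewrite sm3 // sm2 // sm1.
  - by rewrite sm3 // sm2 // sm1.
  - by move=> j; rewrite sm3 // sm2 // sm1.
  - by move=> j; rewrite sm3 // sm2 // sm1.
  - by rewrite sm3 // sm2.
  - by move=> i; rewrite sm3 // sm2 // z1.
move=> s4 _ sm4 [rem gr]; rewrite /= in sm4.
have gW : wsum n w (fun i => s4 11 i != 0) <= W by case: gr.
have [a [b [b0 lo hi rl]]] := greedy_end p_le w_le gr.
apply: wp_cut.
  apply: (@balance_spec n m W p w num den _ _ _ _ _ _ _ _ s4 (fun i => s4 11 i != 0)) => //.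
  - by rewrite sm4 // sm3 // sm2 // sm1.
  - by move=> j; rewrite sm4 // sm3 // sm2 // sm1.
  - by move=> i im; rewrite sm4 // sm3 // c2.
  - by move=> i; rewrite sm4 // sm3 // sm2 // z1.
move=> s5 _ sm5 [pref refE ld bal]; rewrite /= in sm5.
set ref := s5 12 in pref refE ld bal.
have rd : ready n m W M p w ref s5.
  split=> //.
  - by rewrite sm5 // sm4 // sm3 // sm2 // sm1.
  - by rewrite sm5 // sm4 // sm3 // sm2 // sm1.
  - by move=> j; rewrite sm5 // sm4 // sm3 // sm2 // sm1.
  - by move=> j; rewrite sm5 // sm4 // sm3 // sm2 // sm1.
  - by move=> i im; rewrite sm5 // sm4 // pw3.
have m_H' : m.+2 <= H by apply: leq_trans m_H; rewrite -mulnn leq_pmulr.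
have eqS (F : nat -> nat) : \sum_(i < n | ref i == 0) F i = \sum_(i < n | s4 11 i != 0) F i.
  by apply: eq_bigl => i; rewrite refE.
have refW : rejw w n ref <= W by rewrite /rejw eqS.
have V_M : V <= M by apply: leq_trans radius_ge; rewrite leq_pmull.
apply: wp_cut; first by apply: (@dp_spec n m W V M p w ref).
move=> s6 _ sm6 [tv tc]; rewrite /= in sm6.
have rd6 : ready n m W M p w ref s6 by apply: ready_same sm6 _ rd.
apply: wp_cut.
  apply: (@pick_spec n m W V M p w ref c) => //.
  - by rewrite sm6 // sm5 // sm4.
  - by move=> i im; rewrite sm6 // sm5 // sm4 // sm3 // c2.
  - by move=> i; rewrite sm6 // ld.
  (* The reference itself yields a finite final state, that of zero deviation. *)
  exists (encode M.*2.+1 m.+1 (deviation M p ref ref n)).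
    by apply: encode_lt => i _; rewrite /deviation; lia.
  apply: leq_trans refW; apply: (best_complete W w p_le pref pref (leqnn n)).
  by move=> k i _; lia.
move=> s7 _ sm7 [xN xW xmin]; rewrite /= in sm7.
have rd7 : ready n m W M p w ref s7 by apply: ready_same sm7 _ rd6.
apply: wp_imp.
- apply: (@back_spec n m W V M p w ref) => //.
  by move=> u hu; rewrite sm7 // tc.
- exact: leqnn.
move=> s8 _ _ out.
have [t1 t2 t3] := trace_sound pref (leqnn n) xN xW.
have eL i : load p n (s8 5) i = load p n (trace m W M p w ref n (s7 23 0)) i.
  exact: eq_load.
split.
- by move=> j jn; rewrite out // t1.
- by rewrite (eq_rejw w out) t2.
move=> t pt tW.
have -> : span n m p c (s8 5) = span n m p c (trace m W M p w ref n (s7 23 0)).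
  by apply: eq_bigr => i _; rewrite eL.
apply: (trace_optimal p_le pref m_gt0 _ coef_gt0 bal b0 refW _ _ _ radius_ge xN xW xmin) => //.
- by move=> j jn /eqP r0; apply: lo; rewrite // -refE.
- by move=> j jn r0; apply: hi; rewrite // -refE.
- by move=> u uW; have := rl (fun i => u i == 0) uW; rewrite /psum -eqS.
Qed.

End Main.

End Verification.

(** * Word sizes, running time, and the link with instances *)

Section Instance.

Variables (m : nat) (I : instance m).
Hypothesis m_gt0 : 0 < m.

Let n := njobs I.
Let p j := init_memory I 1 j.
Let w j := init_memory I 2 j.
Let num i := init_memory I 3 i.
Let den i := init_memory I 4 i.
Let W := budget I.

Lemma nth_codom_ord (k : nat) (f : 'I_k -> nat) (i : 'I_k) : nth 0 (codom f) i = f i.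
Proof. by rewrite codomE (nth_map i) ?size_enum_ord // nth_ord_enum. Qed.

Lemma ptimeE (j : 'I_n) : p j = ptime j. Proof. exact: nth_codom_ord. Qed.
Lemma weightE (j : 'I_n) : w j = weight j. Proof. exact: nth_codom_ord. Qed.
Lemma numE (i : 'I_m) : num i = `|numq (speed I i)|%N.
Proof. exact: nth_codom_ord (fun i => `|numq (speed I i)|%N) i. Qed.
Lemma denE (i : 'I_m) : den i = `|denq (speed I i)|%N.
Proof. exact: nth_codom_ord (fun i => `|denq (speed I i)|%N) i. Qed.

Lemma speed_num_gt0 i : i < m -> 0 < num i.
Proof.
by move=> im; rewrite (numE (Ordinal im)) absz_gt0 gt_eqF // numq_gt0 speed_gt0.
Qed.

Lemma speed_den_gt0 i : i < m -> 0 < den i.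
Proof. by move=> im; rewrite (denE (Ordinal im)) absz_gt0 denq_neq0. Qed.

Definition bin (o : option 'I_m) : nat := if o is Some i then i.+1 else 0.

Definition agrees (s : schedule I) (t : nat -> nat) : Prop :=
  forall j : 'I_n, t j = bin (s j).

Lemma agrees_proper s t : agrees s t -> on_bins n m t.
Proof. by move=> a j jn; rewrite (a (Ordinal jn)); case: (s _) => //=. Qed.

Lemma agrees_feasible s t : agrees s t -> feasible s = (rejw w n t <= W).
Proof.
move=> a; rewrite /feasible /rejw; congr (_ <= _).
apply: eq_big => [j|j _]; last by rewrite weightE.
by rewrite !inE negbK a; case: (s j).
Qed.

Local Open Scope ring_scope.

Let Q : rat := (\prod_(x < m) num x)%:R.

Lemma Q_gt0 : 0 < Q.
Proof. by rewrite ltr0n; apply: prodn_gt0 => x; apply: speed_num_gt0. Qed.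

(** The inverse speed is den / num, and [num i] divides the product of all numerators, so
    multiplying by [Q] clears the denominators. *)
Lemma agrees_load s t (i : 'I_m) : agrees s t ->
  (\sum_(j | s j == Some i) (ptime j)%:R / speed I i) * Q =
  (coef m num den i.+1 * load p n t i.+1)%N%:R.
Proof.
move=> a; have num0 : (num i)%:R != 0 :> rat.
  by rewrite pnatr_eq0 -lt0n speed_num_gt0.
have den0 : (den i)%:R != 0 :> rat by rewrite pnatr_eq0 -lt0n speed_den_gt0.
have sE : speed I i = (num i)%:R / (den i)%:R.
  rewrite numE denE -[LHS]divq_num_den; congr (_ / _).
    by rewrite -[in LHS](gtz0_abs (_ : 0 < numq (speed I i))) // numq_gt0 speed_gt0.
  by rewrite -[in LHS](gtz0_abs (_ : 0 < denq (speed I i))) // denq_gt0.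
rewrite -mulr_suml -natr_sum /= !natrM.
have -> : Q = ((\prod_(x < m) num x)%N %/ num i)%N%:R * (num i)%:R.
  by rewrite -natrM divnK // (bigD1 i) //= dvdn_mulr.
have -> : load p n t i.+1 = (\sum_(j | s j == Some i) ptime j)%N.
  apply: eq_big => [j|j _]; last by rewrite ptimeE.
  by rewrite a; case: (s j) => [i'|] //=; rewrite eqSS.
by rewrite sE; field; rewrite num0 den0.
Qed.

Lemma agrees_makespan s t : agrees s t ->
  makespan s * Q = (span n m p (coef m num den) t)%:R.
Proof.
(* Bin 0 has coefficient 0, so it matches the base value 0 of the makespan. *)
move=> a; rewrite /makespan /span big_ord_recl /= mul0n max0n.
elim/big_rec2: _ => [|i y x _ e]; first by rewrite mul0r.
by rewrite maxr_pMl ?ltW ?Q_gt0 // e (agrees_load i a) /bump /= add1n -natr_max maxEnat.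
Qed.

Local Close Scope ring_scope.

Local Notation X := (\max_(v <- flatten (input I)) v).+2.

Lemma init_memory_lt a k : init_memory I a k < X.-1.
Proof.
rewrite /= ltnS /init_memory; set r := nth _ _ a.
have [kr|rk] := ltnP k (size r); last by rewrite nth_default.
have ar : a < size (input I) by apply: contraTT kr; rewrite -!leqNgt => ?; rewrite /r nth_default.
have mem : nth 0 r k \in flatten (input I).
  by apply/flattenP; exists r; rewrite mem_nth.
exact: (leq_bigmax_seq (P := predT) (F := fun v => v) _ mem).
Qed.

Let V := maxpw n p w.
Let M := radius n m p w.

Lemma maxpw_lt k : (forall j, p j < k) -> (forall j, w j < k) -> V < k.
Proof.
move=> hp hw; have k0 : 0 < k by apply: leq_ltn_trans (hp 0).
by rewrite -(prednK k0) ltnS; apply/bigmax_leqP => j _; have := hp j; have := hw j; lia.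
Qed.

Lemma maxpw_le : V <= pmax I + wmax I.
Proof.
apply/bigmax_leqP => j _; rewrite ptimeE weightE geq_max.
have h1 : ptime j <= pmax I by apply: leq_bigmax.
have h2 : weight j <= wmax I by apply: leq_bigmax.
by rewrite (leq_trans h1) ?leq_addr // (leq_trans h2) ?leq_addl.
Qed.

(** Chosen so that M <= X ^ e: the constant (m + 1) ^ 2 is at most X to that power, V + 1 is at most
    X, and the product is raised to m + 2. *)
Let e := (m.+1 * m.+1).+1 * m.+2.

(** A sum dominating the exponents of all stored quantities: (e + 2) * (m + 1) for the number of
    states, m + e + 4 for spans, m + 1 for coefficients, (m + 2) ^ 2 for constants, as k <= X ^
    k. *)
Definition word_exponent : nat :=
  (e + 2) * m.+1 + m + e + m.+2 ^ 2 + 10.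

Let H := X ^ word_exponent.

Lemma le_H a i : a <= X ^ i -> i <= word_exponent -> a <= H.
Proof. by move=> h hi; apply: leq_trans h _; rewrite leq_pexp2l. Qed.

Lemma radius_le : M <= X ^ e.
Proof.
rewrite /M /radius /e expnM leq_exp2r // expnSr leq_mul //.
  by rewrite ltnW // ltn_expl.
by apply: maxpw_lt => j; apply: ltnW; apply: init_memory_lt.
Qed.

Lemma base_le : M.*2.+1 <= X ^ (e + 2).
Proof.
have h1 := radius_le; have h2 : 0 < X ^ e by rewrite expn_gt0.
rewrite expnD; apply: leq_trans (_ : X ^ e * 2 ^ 2 <= _).
  by move: h1 h2; move: (X ^ e) => y; lia.
by rewrite leq_mul2l leq_exp2r // orbT.
Qed.

Lemma prod_num_le k : k <= m -> \prod_(x < k) num x <= X ^ m.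
Proof.
move=> km; apply: leq_trans (_ : X ^ k <= _); last by rewrite leq_pexp2l.
rewrite -[k in X ^ k]card_ord -prod_nat_const; apply: leq_prod => x _.
by apply: ltnW; apply: ltnW; apply: init_memory_lt.
Qed.

Lemma coef_le i : coef m num den i <= X ^ m.+1.
Proof.
case: i => // i; rewrite expnS leq_mul //.
  by apply: ltnW; apply: ltnW; apply: init_memory_lt.
exact: leq_trans (leq_div _ _) (prod_num_le (leqnn m)).
Qed.

Lemma sum_ptime_le : \sum_(j < n) p j <= X ^ 2.
Proof.
apply: leq_trans (_ : \sum_(j < n) X <= _).
  by apply: leq_sum => j _; apply: ltnW; apply: ltnW; apply: init_memory_lt.
rewrite sum_nat_const card_ord -mulnn leq_mul //.
by apply: ltnW; apply: ltnW; apply: (init_memory_lt 0 0).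
Qed.

Lemma span_lt i : coef m num den i * (\sum_(j < n) p j + M.*2) < X ^ (m + e + 4).
Proof.
have -> : m + e + 4 = m.+1 + (e + 3) by lia.
rewrite expnD; apply: leq_ltn_trans (_ : X ^ m.+1 * (\sum_(j < n) p j + M.*2) < _).
  by rewrite leq_mul2r coef_le orbT.
rewrite ltn_pmul2l ?expn_gt0 //.
have := sum_ptime_le; have := base_le.
have -> : X ^ (e + 3) = X ^ (e + 2) * X by rewrite -expnSr addnS.
have : X ^ 2 <= X ^ (e + 2) by rewrite leq_pexp2l // leq_addl.
move: (X ^ 2) (X ^ (e + 2)) (\sum_(j < n) p j) => a b d; nia.
Qed.

Definition main_result : memory -> Prop := fun s' =>
    [/\ on_bins n m (s' 5), rejw w n (s' 5) <= W &
      forall t, on_bins n m t -> rejw w n t <= W ->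
        span n m p (coef m num den) (s' 5) <= span n m p (coef m num den) t].

(** Cells are bounded by [H]; the factor 8 in the word size is the largest degree of an
    expression. *)
Lemma main_run : exists s' t, [/\
  exec (word_bound (word_exponent * 8) I) (main_prog m) (init_memory I) s' t,
  t <= running_time n m p w & main_result s'].
Proof.
have X1 : X ^ 1 <= H by apply: le_H (leqnn _) _; rewrite /word_exponent; lia.
have X2 : X ^ 2 <= H by apply: le_H (leqnn _) _; rewrite /word_exponent; lia.
have lt_in a k := init_memory_lt a k.
have VX : V < X.-1 by apply: maxpw_lt => j; apply: lt_in.
have WX : W < X.-1 by apply: (lt_in 0 1).
have nX : n < X.-1 by apply: (lt_in 0 0).
have XX : X + X <= X ^ 2 by rewrite addnn -mul2n -mulnn leq_mul2r orbT.
have bounded0 : bounded H (init_memory I).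
  by move=> a k; have := lt_in a k; rewrite expn1 in X1; lia.
rewrite expn1 in X1.
suff run : wp H (word_bound (word_exponent * 8) I) (main_prog m) (running_time n m p w)
    (init_memory I) main_result.
  by have [s' [t [ex tT _ res]]] := run bounded0; exists s', t.
apply: main_spec => //.
- by apply: leq_trans X1.
- by rewrite /word_bound expnM.
- apply: (@le_H _ (m.+2 ^ 2)); last by rewrite /word_exponent; lia.
  by rewrite ltnW // ltn_expl.
- by apply: leq_trans X1; lia.
- move=> k km; apply: le_H (prod_num_le km) _.
  by rewrite /word_exponent; lia.
- move=> i _; apply: le_H (coef_le i) _.
  by rewrite /word_exponent mulnS; lia.
- by apply: le_H radius_le _; rewrite /word_exponent; lia.
- apply: (@le_H _ ((e + 2) * m.+1)); last by rewrite /word_exponent; lia.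
  by rewrite expnM leq_exp2r // base_le.
- by apply: leq_trans X1; lia.
- apply: (@le_H _ 3); last by rewrite /word_exponent; lia.
  apply: leq_trans (_ : V.+1 * V.+1 * V.+1 <= _).
    by rewrite -/V; move: (V) => v; nia.
  by rewrite !expnS expn0 muln1 mulnA !leq_mul //; lia.
- exact: leq_trans sum_ptime_le X2.
- by apply: leq_trans X2; apply: leq_trans XX; rewrite -/V; lia.
- move=> i _; apply: leq_trans (span_lt i) _.
  by apply: le_H (leqnn _) _; rewrite /word_exponent; lia.
- exact: speed_num_gt0.
- exact: speed_den_gt0.
- by case=> [|[|[|[|[|a]]]]] // k _; rewrite /init_memory /= nth_default ?nth_nil.
Qed.

Lemma main_optimal s' : main_result s' ->
  exists s : schedule I, output_is s s' /\ optimal s.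
Proof.
case=> ps rs os.
pose s : schedule I := [ffun j : 'I_n => if s' 5 j is i.+1 then insub i else None].
have ag : agrees s (s' 5).
  move=> j; rewrite ffunE; have := ps j (ltn_ord j).
  by case: (s' 5 j) => //= i im; rewrite insubT.
exists s; split; first by move=> j; rewrite (ag j).
split; first by rewrite (agrees_feasible ag).
move=> s2 f2.
pose t j := if insub j is Some j' then bin (s2 j') else 0.
have ag2 : agrees s2 t by move=> j; rewrite /t valK.
have le := os t (agrees_proper ag2); rewrite -(agrees_feasible ag2) in le.
rewrite -(ler_pM2r Q_gt0) (agrees_makespan ag) (agrees_makespan ag2) ler_nat.
exact: le.
Qed.

(** With P = p_max + w_max, V + 1 <= 2 * P and 2 * M + 1 <= 3 * M bound the number of states by A *
    P ^ ((m + 2) * (m + 1)). The 1700 is 8 * 200 + 100, from (V + 1) ^ 3 <= 8 * P ^ 3. *)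
Definition time_constant : nat :=
  let A := (3 * (2 * (m.+1 * m.+1)) ^ m.+2) ^ m.+1 in
  let q := m.+1 * 150 + 200 in
  120 + (m * 100 + 50) + (m * 100 + 200) + 1700 + (m * 100 + 200)
  + (2 * A * q + 200) + (A * q + 100) + 150.

Lemma running_time_le :
  0 < (pmax I + wmax I) ^ ((m + 2) * (m + 3)) * n ->
  running_time n m p w <=
    time_constant * ((pmax I + wmax I) ^ ((m + 2) * (m + 3)) * n).
Proof.
have := maxpw_le; move: (pmax I + wmax I) => P VP.
rewrite muln_gt0 => /andP[G0 n0]; set G := P ^ _ in G0 *.
have P0 : 0 < P by move: G0; rewrite expn_gt0 => /orP[//|]; rewrite addn2 addn3.
have V2 : V.+1 <= 2 * P by lia.
have V3 : V.+1 ^ 3 <= 8 * G.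
  apply: leq_trans (_ : (2 * P) ^ 3 <= _); first by rewrite leq_exp2r.
  by rewrite expnMn; apply: leq_mul => //; apply: leq_pexp2l => //; nia.
rewrite /time_constant; set A := _ ^ m.+1.
have Ns_le : M.*2.+1 ^ m.+1 <= A * G.
  apply: leq_trans (_ : (3 * (2 * (m.+1 * m.+1)) ^ m.+2 * P ^ m.+2) ^ m.+1 <= _).
    rewrite leq_exp2r // -mulnA -expnMn.
    have M0 : 0 < M by rewrite /M /radius expn_gt0.
    apply: leq_trans (_ : 3 * M <= _); first by lia.
    rewrite leq_mul2l /M /radius leq_exp2r // -/V.
    by rewrite /= (mulnC 2) -(mulnA _ 2 P) leq_mul2l V2 orbT.
  (* The exponent (m + 2) * (m + 1) of the state count is below the allowed (m + 2) * (m + 3). *)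
  by rewrite expnMn -expnM leq_mul2l leq_pexp2l ?orbT //; lia.
rewrite /running_time -/V -/M.
move: (M.*2.+1 ^ m.+1) (V.+1 ^ 3) A V3 Ns_le => N3 V3 A hV hN.
set q := m.+1 * 150 + 200.
have g1 : n <= G * n by rewrite leq_pmull.
have g2 : G <= G * n by rewrite leq_pmulr.
have g0 : 0 < G * n by rewrite muln_gt0 G0.
have t4 : V3 * (n * 100 + 100) + 100 <= 1700 * (G * n).
  apply: leq_trans (_ : 8 * G * (n * 200) + 100 <= _); last by lia.
  by rewrite leq_add2r leq_mul //; lia.
have t5 : n * (m * 100 + 100) + 100 <= (m * 100 + 200) * (G * n).
  by have := leq_mul g1 (leqnn (m * 100 + 100)); lia.
have t6 : n.+1 * (N3 * q + 100) <= (2 * A * q + 200) * (G * n).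
  apply: leq_trans (_ : (2 * n) * (A * G * q + 100 * G) <= _); last by lia.
  apply: leq_mul; first by lia.
  by apply: leq_add; [rewrite leq_mul2r hN orbT|lia].
have t7 : N3 * q + 100 <= (A * q + 100) * (G * n).
  apply: leq_trans (_ : A * G * q + 100 <= _).
    by rewrite leq_add2r leq_mul2r hN orbT.
  have := leq_mul (leqnn (A * q)) g2; lia.
have tm k : m * 100 + k <= (m * 100 + k) * (G * n) by rewrite leq_pmulr.
rewrite !mulnDl; have := tm 50; have := tm 200; rewrite !mulnDl in t4 t5 t6 t7 *.
lia.
Qed.

End Instance.

Theorem theorem5 (m : nat) (hm : 0 < m) :
  solvable_in_soft_O
    (fun I : instance m =>
       (pmax I + wmax I) ^ ((m + 2) * (m + 3)) * njobs I).
Proof.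
(* The logarithm gets exponent 0: the time is at most a constant times the stated quantity. *)
exists (main_prog m), (word_exponent m * 8), (time_constant m), 0 => I.
have [st [t [ex le_t res]]] := main_run I hm.
have [s [out opt]] := main_optimal res.
exists st, t, s; split=> // f_gt0.
rewrite expn0 muln1; apply: leq_trans le_t _.
exact: running_time_le.
Qed.
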